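(* There exist two functions $f,g\in\mathcal{B}$, both of finite order, such that $f$ and $g$ are topologically equivalent but $\rho(f)\neq\rho(g)$.
   Context: For an entire function $f:\mathbb{C}\to\mathbb{C}$, the order is $\rho(f)=\limsup_{z\to\infty}\frac{\log_+\log_+|f(z)|}{\log|z|}\in[0,\infty]$, where $\log_+x=\max(0,\log x)$. The set of singular values $S(f)$ is the smallest closed set $S\subset\mathbb{C}$ such that $f:f^{-1}(\mathbb{C}\setminus S)\to\mathbb{C}\setminus S$ is a covering map; equivalently, the closure in $\mathbb{C}$ of the set of all critical and finite asymptotic values of $f$. The Eremenko-Lyubich class $\mathcal{B}$ is the set of transcendental entire functions $f$ for which $S(f)$ is bounded. Two entire functions $f$ and $g$ are topologically equivalent if there are orientation-preserving homeomorphisms $\phi,\psi:\mathbb{C}\to\mathbb{C}$ such that $\psi\circ f=g\circ\phi$. *)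

(* Defs.v *)
From HB Require Import structures.
From mathcomp Require Import all_boot all_order all_algebra complex.
From mathcomp Require Import all_classical all_reals all_analysis.

Set Implicit Arguments.
Unset Strict Implicit.
Unset Printing Implicit Defensive.

Import Order.TTheory GRing.Theory Num.Theory numFieldNormedType.Exports.

Local Open Scope classical_set_scope.
Local Open Scope ring_scope.
Local Open Scope complex_scope.

(* The complex plane, as a one-dimensional normed module over itself: this is
   the copy of R[i] that carries a topology, and [derivable f z 1] is then
   complex differentiability of f at z. *)
Notation CC R := (complex R)^o.

Section Topology.
Context {X Y : topologicalType}.

Definition homeomorphism_on (U : set X) (V : set Y) (f : X -> Y) : Prop :=
  exists g : Y -> X,
    [/\ set_fun U V f, set_fun V U g, {in U, cancel f g} & {in V, cancel g f}]
    /\ {within U, continuous f} /\ {within V, continuous g}.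

Definition evenly_covered (f : X -> Y) (V : set Y) : Prop :=
  exists F : set (set X),
    [/\ (forall U, F U -> open U),
        trivIset F id,
        f @^-1` V = \bigcup_(U in F) U
      & forall U, F U -> homeomorphism_on U V f].

(* For f continuous and W open: f restricts to a covering map from
   f @^-1` W to W.  Empty fibres are allowed. *)
Definition covering_over (f : X -> Y) (W : set Y) : Prop :=
  forall w, W w ->
    exists V : set Y, [/\ open V, V w, V `<=` W & evenly_covered f V].

(* The smallest closed set off which f is a covering map; it exists by
   [singular_set_smallest]. *)
Definition singular_set (f : X -> Y) : set Y :=
  \bigcap_(S in [set S | closed S /\ covering_over f (~` S)]) S.

Lemma singular_set_smallest (f : X -> Y) :
  [/\ closed (singular_set f),
      covering_over f (~` singular_set f)
    & forall S, closed S -> covering_over f (~` S) -> singular_set f `<=` S].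
Proof.
split.
- by apply: closed_bigI => S [].
- move=> w nSw.
  have [S [[clS cov] nS]] : exists S, (closed S /\ covering_over f (~` S)) /\ ~ S w.
    apply: contrapT => noS; apply: nSw => S Sprop.
    by apply: contrapT => nS; apply: noS; exists S.
  have [V [oV Vw VS eV]] := cov w nS.
  exists V; split => // v Vv Sv; apply: (VS v Vv).
  by apply: Sv.
- by move=> S clS cov v; apply.
Qed.

End Topology.

Section Plane.
Context {R : realType}.
Implicit Types (f g phi psi : CC R -> CC R) (z p : CC R).

(* e^{it} *)
Definition expi (t : R) : CC R := cos t +i* sin t.

(* theta is a continuous determination of the argument of gamma - p. *)
Definition winding_number_is (gamma : R -> CC R) p (n : int) : Prop :=
  exists theta : R -> R,
    [/\ {within `[0, 1], continuous theta},
        (forall t : R, t \in `[0, 1] -> gamma t != p),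
        (forall t : R, t \in `[0, 1] ->
           gamma t - p = `|gamma t - p| * expi (theta t))
      & theta 1 - theta 0 = n%:~R * (2 * pi)].

Definition circle z (r t : R) : CC R := z + r%:C * expi (t * (2 * pi)).

(* Local degree +1 at every point. *)
Definition orientation_preserving phi : Prop :=
  forall z (r : R), 0 < r -> winding_number_is (phi \o circle z r) (phi z) 1.

Definition topologically_equivalent f g : Prop :=
  exists phi psi,
    [/\ homeomorphism_on setT setT phi, orientation_preserving phi,
        homeomorphism_on setT setT psi, orientation_preserving psi
      & psi \o f = g \o phi].

Definition entire f : Prop := forall z, derivable f z 1.

Definition transcendental f : Prop :=
  ~ exists q : {poly R[i]}, forall z, f z = q.[z].

Definition class_B f : Prop :=
  [/\ entire f, transcendental f & bounded_set (singular_set f)].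

(* [ln] is 0 on nonpositive reals, so log_plus 0 = 0 as it should. *)
Definition log_plus (x : R) : R := Num.max 0 (ln x).

(* z --> infinity in the plane *)
Definition at_infinity : set_system (CC R) :=
  filter_from [set: R] (fun M => [set z | M < Normc.normc z]).

Definition growth_order f : \bar R :=
  limf_esup
    (fun z => (log_plus (log_plus (Normc.normc (f z)))
                 / ln (Normc.normc z))%:E)
    at_infinity.

End Plane.

(* Main.v *)
Require Import Defs.
From mathcomp Require Import all_boot all_order all_algebra complex.
From mathcomp Require Import all_classical all_reals all_analysis.
From mathcomp Require Import ring lra zify.

(* Let p(z) = z^3 + a have a repelling fixed point be of multiplier la = 3 be^2.
   Its Poincaré function, the entire solution of f(la z) = p(f z) with f(0) = be
   and f'(0) = 1, has order ln 3 / ln |la|, and its singular values lie in any disc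
   that p maps into itself and that contains the critical point.  A conjugacy h of
   p to q(z) = z^3 + b lifts to a homeomorphism phi with h \o f = g \o phi, so it
   suffices that p and q are conjugate with |la| different.

   Take a = 36/125, be = 4/5 and b = e^{i th} a with th small.  If the multipliers
   had the same modulus, so would the fixed points, and |a| = |b| would give
   b = a or b = - a.  The conjugacy is the limit of h_{n+1} = q^{-1} h_n p outside
   the disc D of radius 3/5, where q expands, and h_{n+1} = q h_n p^{-1} on p(D),
   where q contracts; h_0 is a radial twist, equal to the rotation by th on p(D).
   All h_n are 1/100-close to the identity, which selects the branch of q^{-1}. *)

Set Implicit Arguments.
Unset Strict Implicit.
Unset Printing Implicit Defensive.

Import Order.TTheory GRing.Theory Num.Theory numFieldNormedType.Exports.

Local Open Scope classical_set_scope.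
Local Open Scope ring_scope.
Local Open Scope complex_scope.

(** * The plane with its real-valued modulus *)

(** The constants come from a window: [r ^ 3 + |a| < 1 / sqrt 3 < r], where [a = be - be ^ 3], makes
    the derivative of the cube exceed 1 in modulus outside D and stay below 1 on p(D). With
    [be = 4/5] and [r = 3/5] one gets [|a| = 36/125], p(D) inside the disc of radius 63/125, and
    multiplier 48/25. The obstacle is that p is three-to-one: q h p^{-1} is single-valued on p(D)
    only if h commutes with multiplication by the cube roots of unity. To keep this symmetry, the
    formula is rotated to the other two copies of p(D), which are disjoint from it. The angles th on
    p(D) and th/3 on |z| = r fit together because q(e^{i th/3} z) = e^{i th} p(z); this identity
    glues the pieces of every h_n. The same construction from q to p with angle -th inverts the h_n
    one by one, so bijectivity of the limit needs no topological argument. The conjugacy need not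
    respect the multiplier, yet the lift satisfies phi(la z) = mu phi(z), and each order is read off
    from |la| or |mu|. *)

Section Modulus.
Context {R : realType}.
Implicit Types (x y z w : CC R) (f g : CC R -> CC R).

(* The library norm `|z| is a complex number; this one is real. *)
Definition nm (z : CC R) : R := Normc.normc z.
Arguments nm : simpl never.

Lemma nm_ge0 z : 0 <= nm z. Proof. by case: z => a b; rewrite /nm /= sqrtr_ge0. Qed.
Lemma nm0 : nm 0 = 0. Proof. exact: Normc.normc0. Qed.
Lemma nm1 : nm 1 = 1. Proof. exact: Normc.normc1. Qed.
Lemma nmM x y : nm (x * y) = nm x * nm y. Proof. exact: Normc.normcM. Qed.
Lemma nmV x : nm x^-1 = (nm x)^-1. Proof. exact: Normc.normcV. Qed.
Lemma nmN x : nm (- x) = nm x. Proof. exact: normcN. Qed.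
Lemma nmD x y : nm (x + y) <= nm x + nm y. Proof. exact: le_normcD. Qed.
Lemma nm_eq0 x : nm x = 0 -> x = 0. Proof. exact: Normc.eq0_normc. Qed.
Lemma nm_real (t : R) : nm t%:C = `|t|.
Proof. by rewrite /nm /= expr0n /= addr0 sqrtr_sqr. Qed.
Lemma nmX x n : nm (x ^+ n) = nm x ^+ n.
Proof. by elim: n => [|n IH]; rewrite ?expr0 ?nm1 // !exprS nmM IH. Qed.
Lemma nmC x y : nm (x - y) = nm (y - x). Proof. by rewrite -nmN opprB. Qed.
Lemma nmB x y : nm (x - y) <= nm x + nm y. Proof. by rewrite -(nmN y) nmD. Qed.
Lemma nm_tri y x z : nm (x - z) <= nm (x - y) + nm (y - z).
Proof. by apply: le_trans (nmD _ _); rewrite addrA subrK. Qed.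
Lemma nm_sub x y : nm x - nm y <= nm (x - y).
Proof. by rewrite lerBlDr; apply: le_trans (nmD _ _); rewrite subrK. Qed.
Lemma nm_add x y : nm x - nm y <= nm (x + y).
Proof. by rewrite -[y]opprK nmN nm_sub. Qed.
Lemma nm_nat n : nm n%:R = n%:R.
Proof.
by rewrite -[n%:R in LHS](rmorph_nat (real_complex R)) nm_real ger0_norm.
Qed.
Lemma nm_gt0 x : x != 0 -> 0 < nm x.
Proof.
by move=> x0; rewrite lt0r nm_ge0 andbT; apply: contra_neq x0; exact: nm_eq0.
Qed.
Lemma nm_le0 x : nm x <= 0 -> x = 0.
Proof. by move=> h; apply: nm_eq0; apply/eqP; rewrite eq_le h nm_ge0. Qed.
Lemma nm_normr x : `|x| = (nm x)%:C. Proof. by rewrite normc_def /nm; case: x. Qed.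

Definition cont_at f z := forall e : R, 0 < e ->
  exists2 d : R, 0 < d & forall w, nm (w - z) < d -> nm (f w - f z) < e.

Lemma gt0_complex (e : CC R) : 0 < e -> exists2 d : R, 0 < d & e = d%:C.
Proof.
by case: e => a b; rewrite ltcE /= => /andP[/eqP -> h]; exists a.
Qed.

Lemma near_nm (P : CC R -> Prop) z :
  (\forall w \near z, P w) <-> exists2 d : R, 0 < d & forall w, nm (w - z) < d -> P w.
Proof.
split.
  move/nbhs_ballP => [e /= /gt0_complex[d d0 ->] h]; exists d => // w hw.
  by apply: h; rewrite /ball /= nm_normr nmC ltcR.
move=> [d d0 h]; apply/nbhs_ballP; exists d%:C => /=; first by rewrite ltcR.
move=> w; rewrite /ball /= nm_normr nmC ltcR; exact: h.
Qed.

Lemma cvg_nm (T : Type) (F : set_system T) (FF : Filter F) (f : T -> CC R) l :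
  f @ F --> l <-> (forall e : R, 0 < e -> \forall t \near F, nm (f t - l) < e).
Proof.
split=> [/cvgrPdist_lt h e e0|h].
  have := h e%:C; rewrite ltcR => /(_ e0); apply: filterS => t.
  by rewrite nm_normr nmC ltcR.
apply/cvgrPdist_lt => _ /gt0_complex[d d0 ->]; apply: filterS (h d d0) => t.
by rewrite nm_normr nmC ltcR.
Qed.

Lemma cont_atP f z : cont_at f z <-> {for z, continuous f}.
Proof.
rewrite /continuous_at; split=> [h|/cvg_nm h].
  by apply/(@cvg_nm _ _ (nbhs_filter z)) => e e0; apply/near_nm; exact: h.
by move=> e e0; apply/near_nm; exact: h.
Qed.

Lemma cont_at_id z : cont_at id z. Proof. by move=> e e0; exists e. Qed.
Lemma cont_at_cst c z : cont_at (fun=> c) z.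
Proof. by move=> e e0; exists 1 => // w _; rewrite subrr nm0. Qed.
Lemma cont_at_comp f g z : cont_at g z -> cont_at f (g z) -> cont_at (f \o g) z.
Proof.
move=> cg cf e e0; have [d d0 hd] := cf e e0; have [d' d'0 hd'] := cg d d0.
by exists d' => // w /hd'/hd.
Qed.
Lemma cont_atD f g z : cont_at f z -> cont_at g z -> cont_at (fun w => f w + g w) z.
Proof.
move=> /cont_atP hf /cont_atP hg; apply/cont_atP.
exact: (@continuousD _ _ _ f g z hf hg).
Qed.
Lemma cont_atM f g z : cont_at f z -> cont_at g z -> cont_at (fun w => f w * g w) z.
Proof.
move=> /cont_atP hf /cont_atP hg; apply/cont_atP.
exact: (@continuousM _ _ f g z hf hg).
Qed.
Lemma cont_atN f z : cont_at f z -> cont_at (fun w => - f w) z.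
Proof. by move=> /cont_atP hf; apply/cont_atP; exact: (@continuousN _ _ _ f z hf). Qed.
Lemma cont_atB f g z : cont_at f z -> cont_at g z -> cont_at (fun w => f w - g w) z.
Proof. by move=> hf hg; apply: cont_atD => //; apply: cont_atN. Qed.
Lemma cont_atX f n z : cont_at f z -> cont_at (fun w => f w ^+ n) z.
Proof.
move=> hf; elim: n => [|n IH]; first exact: cont_at_cst.
under [X in cont_at X]eq_fun do rewrite exprS.
exact: cont_atM.
Qed.
Lemma cont_at_near f g z (d : R) : 0 < d -> (forall w, nm (w - z) < d -> f w = g w) ->
  cont_at f z -> cont_at g z.
Proof.
move=> d0 fg cf e e0; have [d' d'0 h] := cf e e0.
exists (Num.min d d'); first by rewrite lt_min d0.
move=> w; rewrite lt_min => /andP[h1 h2]; rewrite -!fg ?h//.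
by rewrite subrr nm0.
Qed.

Lemma geo_lt (c k e : R) : 0 <= k < 1 -> 0 < e ->
  exists N, forall n, (N <= n)%N -> c * k ^+ n < e.
Proof.
move=> /andP[k0 k1] e0.
have /cvgrPdist_lt h : (fun n => k ^+ n) @ \oo --> (0 : R).
  by apply: cvg_expr; rewrite ger0_norm.
have [|N _ hN] := h (e / (`|c| + 1)); first by rewrite divr_gt0// ltr_pwDr.
exists N => n /hN /=; rewrite sub0r normrN => hn.
apply: le_lt_trans (ler_norm _) _; rewrite normrM.
have c1 : 0 < `|c| + 1 by rewrite ltr_pwDr.
rewrite ltr_pdivlMr// in hn; apply: le_lt_trans hn.
by rewrite mulrC ler_wpM2l// lerDl.
Qed.

(** The tails telescope: [E n - E n.+1 = c * k ^+ n]. Hence [u - E] is nondecreasing, [u + E] is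
    nonincreasing, and the supremum of the former lies between the two. *)
Lemma geo_limR (u : nat -> R) (c k : R) : 0 <= k < 1 ->
  (forall n, `|u n.+1 - u n| <= c * k ^+ n) ->
  exists l, forall n, `|u n - l| <= c * k ^+ n / (1 - k).
Proof.
move=> /andP[k0 k1] hu.
have k10 : 1 - k != 0 by rewrite subr_eq0 eq_sym lt_eqF.
pose E n := c * k ^+ n / (1 - k).
have ES n : E n - E n.+1 = c * k ^+ n.
  by rewrite /E exprS; field.
have E0 n : 0 <= E n.
  apply: divr_ge0; last by rewrite subr_ge0 ltW.
  exact: le_trans (hu n).
have inc m n : u m - E m <= u (m + n)%N - E (m + n)%N.
  elim: n => [|n IH]; rewrite ?addn0 // addnS.
  have := hu (m + n)%N; rewrite ler_norml -ES => /andP[]; lra.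
have dec m n : u (m + n)%N + E (m + n)%N <= u m + E m.
  elim: n => [|n IH]; rewrite ?addn0 // addnS.
  have := hu (m + n)%N; rewrite ler_norml -ES => /andP[]; lra.
pose S := [set u n - E n | n in [set: nat]].
have ub m : ubound S (u m + E m).
  move=> _ [n _ <-]; have := inc n m; have := dec m n; rewrite addnC.
  by have := E0 (n + m)%N; lra.
have hS : has_sup S by split; [exists (u 0%N - E 0%N), 0%N|exists (u 0%N + E 0%N); exact: ub].
exists (sup S) => n; rewrite -/(E n) ler_norml; apply/andP; split.
  have : sup S <= u n + E n by apply: ge_sup; [case: hS|exact: ub].
  by lra.
have : u n - E n <= sup S by apply: ub_le_sup; [case: hS|exists n].
by lra.
Qed.

Definition clim (u : nat -> CC R) (l : CC R) := forall e : R, 0 < e ->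
  exists N, forall n, (N <= n)%N -> nm (u n - l) < e.

Lemma nm_ReIm z : nm z <= `|complex.Re z| + `|complex.Im z|.
Proof.
case: z => a b /=; rewrite /nm /=.
have h : 0 <= `|a| + `|b| by rewrite addr_ge0.
rewrite -[leRHS]ger0_norm// -sqrtr_sqr ler_wsqrtr// sqrrD !real_normK ?num_real//.
by rewrite lerD2r lerDl mulrn_wge0// mulr_ge0.
Qed.
Lemma Re_le_nm z : `|complex.Re z| <= nm z.
Proof. by have := normc_ge_Re z; rewrite nm_normr lecR. Qed.
Lemma ReB z w : complex.Re (z - w) = complex.Re z - complex.Re w.
Proof. by case: z w => [a b] [c d]. Qed.
Lemma ImB z w : complex.Im (z - w) = complex.Im z - complex.Im w.
Proof. by case: z w => [a b] [c d]. Qed.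
Lemma Im_le_nm z : `|complex.Im z| <= nm z.
Proof.
case: z => a b; rewrite /nm /= -sqrtr_sqr ler_wsqrtr// lerDr sqr_ge0 //.
Qed.

(** The factor 2 comes from adding the errors of the real and imaginary parts. *)
Lemma geo_lim (u : nat -> CC R) (c k : R) : 0 <= k < 1 ->
  (forall n, nm (u n.+1 - u n) <= c * k ^+ n) ->
  exists l : CC R, (forall n, nm (u n - l) <= 2 * (c * k ^+ n / (1 - k))) /\ clim u l.
Proof.
move=> hk hu.
have [|a ha] := @geo_limR (fun n => complex.Re (u n)) c k hk.
  move=> n; apply: le_trans (hu n); rewrite -ReB; exact: Re_le_nm.
have [|b hb] := @geo_limR (fun n => complex.Im (u n)) c k hk.
  move=> n; apply: le_trans (hu n); rewrite -ImB; exact: Im_le_nm.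
have H n : nm (u n - (a +i* b)) <= 2 * (c * k ^+ n / (1 - k)).
  apply: le_trans (nm_ReIm _) _; rewrite ReB ImB /= mulr_natl mulr2n.
  exact: lerD.
exists (a +i* b); split => // e e0.
have [N hN] := geo_lt (2 * c / (1 - k)) hk e0.
exists N => n /hN; apply: le_lt_trans; apply: le_trans (H n) _.
by rewrite !mulrA [_ / _ * _]mulrAC.
Qed.

Lemma clim_le u (l c : CC R) (e : R) : clim u l -> (forall n, nm (u n - c) <= e) -> nm (l - c) <= e.
Proof.
move=> h he; apply/ler_addgt0Pr => d d0; have [N /(_ N (leqnn _)) hN] := h d d0.
have := nm_tri (u N) l c; rewrite (nmC l (u N)); have := he N; lra.
Qed.
Lemma clim_ge u (l c : CC R) (e : R) : clim u l -> (forall n, e <= nm (u n - c)) -> e <= nm (l - c).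
Proof.
move=> h he; apply/ler_addgt0Pr => d d0; have [N /(_ N (leqnn _)) hN] := h d d0.
have := nm_tri l (u N) c; have := he N; lra.
Qed.
Lemma clim_cont u (l : CC R) f : clim u l -> cont_at f l -> clim (f \o u) (f l).
Proof.
move=> h cf e e0; have [d d0 hd] := cf e e0; have [N hN] := h d d0.
by exists N => n /hN/hd.
Qed.
Lemma clim_uniq u (l l' : CC R) : clim u l -> clim u l' -> l = l'.
Proof.
move=> h h'; apply/eqP; rewrite -subr_eq0; apply/eqP/nm_le0.
apply/ler_addgt0Pr => d d0; rewrite add0r.
have [N hN] := h (d / 2) (divr_gt0 d0 (ltr0Sn _ _)).
have [N' hN'] := h' (d / 2) (divr_gt0 d0 (ltr0Sn _ _)).
have := hN _ (leq_maxl N N'); have := hN' _ (leq_maxr N N').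
move: (maxn _ _) => n; have := nm_tri (u n) l l'; rewrite (nmC l (u n)); lra.
Qed.
Lemma clim_ext u v (l : CC R) : (forall n, u n = v n) -> clim u l -> clim v l.
Proof. by move=> /funext ->. Qed.
Lemma clim_shift u (l : CC R) : clim u l -> clim (fun n => u n.+1) l.
Proof. by move=> h e /h[N hN]; exists N => n hn; apply: hN; rewrite leqW. Qed.
End Modulus.
Arguments nm : simpl never.

(** * Cubes and cube roots *)

Section Cubes.
Context {R : realType}.
Implicit Types (u v w z W : CC R).

Lemma cube_sub u v : u ^+ 3 - v ^+ 3 = (u - v) * (u ^+ 2 + u * v + v ^+ 2).
Proof. by ring. Qed.

Lemma cube_le (x y : R) : 0 <= x -> 0 <= y -> (x ^+ 3 <= y ^+ 3) = (x <= y).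
Proof. by move=> x0 y0; rewrite ler_pXn2r. Qed.

Lemma quad_form_ge u v :
  3 * nm u ^+ 2 - 3 * nm u * nm (u - v) - nm (u - v) ^+ 2
    <= nm (u ^+ 2 + u * v + v ^+ 2).
Proof.
have -> : u ^+ 2 + u * v + v ^+ 2 = 3 * u ^+ 2 - (3 * u * (u - v) - (u - v) ^+ 2) by ring.
apply: le_trans (nm_sub _ _).
have := nmB (3 * u * (u - v)) ((u - v) ^+ 2).
rewrite !(nmX, nmM) (nm_nat 3); lra.
Qed.

Lemma quad_form_le u v :
  nm (u ^+ 2 + u * v + v ^+ 2) <= nm u ^+ 2 + nm u * nm v + nm v ^+ 2.
Proof.
by rewrite -!nmX -nmM; do 2![apply: le_trans (nmD _ _) _; rewrite ?lerD2r].
Qed.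

(** At [u] the derivative of the cube has modulus at least 27/25; a displacement of at most 1/50
    still leaves 26/25. Only one of the two points has to lie outside D. *)
Lemma cube_expand u v : 3 / 5 <= nm u -> nm (u - v) <= 1 / 50 ->
  26 / 25 * nm (u - v) <= nm (u ^+ 3 - v ^+ 3).
Proof.
move=> hu hd; rewrite cube_sub nmM mulrC ler_wpM2l ?nm_ge0//.
apply: le_trans (quad_form_ge u v).
have := nm_ge0 (u - v); nra.
Qed.

Lemma cube_inj_near u v : 3 / 5 <= nm u -> nm (u - v) <= 1 / 50 ->
  u ^+ 3 = v ^+ 3 -> u = v.
Proof.
move=> hu hd e; have := cube_expand hu hd; rewrite e subrr nm0 => h.
by apply/eqP; rewrite -subr_eq0; apply/eqP/nm_le0; lra.
Qed.

Lemma unity3_quad w : w ^+ 3 = 1 -> w != 1 -> w ^+ 2 + w + 1 = 0.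
Proof.
move=> w3 w1; have : (w - 1) * (w ^+ 2 + w + 1) = 0.
  by transitivity (w ^+ 3 - 1); [ring|rewrite w3 subrr].
by move=> /eqP; rewrite mulf_eq0 subr_eq0 (negbTE w1) /= => /eqP.
Qed.

Lemma unity3_nm w : w ^+ 3 = 1 -> nm w = 1.
Proof.
move=> w3; have : nm w ^+ 3 = 1 by rewrite -nmX w3 nm1.
by move=> /eqP; rewrite pexpr_eq1 ?nm_ge0// => /eqP.
Qed.

Lemma unity3_dist w : w ^+ 3 = 1 -> w != 1 -> nm (w - 1) ^+ 2 = 3.
Proof.
move=> w3 w1; have q := unity3_quad w3 w1.
have : (w - 1) * (w - 1) * w ^+ 2 = - w ^+ 3 * 3 + (w ^+ 2 + w + 1) * (w^+2) by ring.
rewrite q w3 mul0r addr0 => /(congr1 nm).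
by rewrite mulN1r nmN (nm_nat 3) nmM nmX (unity3_nm w3) expr1n mulr1 nmM.
Qed.

Lemma unity3_sqr w : w ^+ 3 = 1 -> (w ^+ 2) ^+ 3 = 1.
Proof. by move=> w3; rewrite -exprM mulnC exprM w3 expr1n. Qed.

Lemma unity3_ex : exists2 w : CC R, w ^+ 2 + w + 1 = 0 & w ^+ 3 = 1.
Proof.
suff [w hw] : exists w : CC R, w ^+ 2 + w + 1 = 0.
  exists w => //; transitivity ((w - 1) * (w ^+ 2 + w + 1) + 1); first by ring.
  by rewrite hw mulr0 add0r.
pose s : CC R := sqrtC (- 3%:R).
exists ((s - 1) / 2); have : s ^+ 2 = - 3%:R by exact: sqrtCK.
move=> e; have -> : ((s - 1) / 2) ^+ 2 + (s - 1) / 2 + 1 = (s ^+ 2 + 3%:R) / 4 by field.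
by rewrite e addNr mul0r.
Qed.

Lemma cube_root_ex W : exists u, u ^+ 3 = W.
Proof. by exists (3.-root (W : R[i])); rewrite rootCK. Qed.

(* [z^3 - W] is the product of the distances from [z] to the three roots. *)
Lemma cube_root_near z W : exists2 u, u ^+ 3 = W & nm (z - u) ^+ 3 <= nm (z ^+ 3 - W).
Proof.
have [w hw w3] := unity3_ex; have [u hu] := cube_root_ex W.
have e : z ^+ 3 - W = (z - u) * (z - w * u) * (z - w ^+ 2 * u).
  rewrite -hu; apply/eqP; rewrite -subr_eq0; apply/eqP.
  have -> : z ^+ 3 - u ^+ 3 - (z - u) * (z - w * u) * (z - w ^+ 2 * u) =
    (w ^+ 2 + w + 1) * (z ^+ 2 * u) - (w ^+ 2 + w + 1) * (w * z * u ^+ 2)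
      + (w ^+ 3 - 1) * u ^+ 3 by ring.
  by rewrite hw w3 subrr !mul0r subrr add0r.
have h1 : (w * u) ^+ 3 = W by rewrite exprMn w3 hu mul1r.
have h2 : (w ^+ 2 * u) ^+ 3 = W by rewrite exprMn (unity3_sqr w3) hu mul1r.
rewrite e !nmM.
have := nm_ge0 (z - u); have := nm_ge0 (z - w * u); have := nm_ge0 (z - w ^+ 2 * u).
set a := nm (z - u); set b := nm (z - w * u); set c := nm _ => c0 b0 a0.
have [ab|ba] := leP a b; have [ac|ca] := leP a c.
- exists u => //; rewrite -/a !exprS expr0 mulr1 mulrA.
  by rewrite ler_pM// ?mulr_ge0// ler_wpM2l.
- exists (w ^+ 2 * u) => //; rewrite -/c !exprS expr0 mulr1 mulrA.
  by rewrite ler_wpM2r// ler_pM// ltW// (lt_le_trans ca).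
- exists (w * u) => //; rewrite -/b !exprS expr0 mulr1 mulrA.
  by rewrite ler_pM ?mulr_ge0// ?ler_wpM2r// ltW// (lt_le_trans ba).
have [bc|cb] := leP b c.
  exists (w * u) => //; rewrite -/b !exprS expr0 mulr1 mulrA.
  by rewrite ler_pM ?mulr_ge0// ?ler_wpM2r// ltW.
exists (w ^+ 2 * u) => //; rewrite -/c !exprS expr0 mulr1 mulrA.
by rewrite ler_wpM2r// ler_pM// ltW.
Qed.

(** Nearness to [z] selects the branch of the cube root. The tolerance 1/96 lies between
    [1 / 100 + 1 / 1000 * (36 / 125)], the error met in a pullback step, and [(7 / 32) ^ 3]. *)
Lemma cube_root_lift z W : 3 / 5 <= nm z -> 27 / 125 <= nm W ->
  nm (z ^+ 3 - W) <= 1 / 96 ->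
  exists u, [/\ u ^+ 3 = W, 3 / 5 <= nm u & 26 / 25 * nm (u - z) <= nm (z ^+ 3 - W)].
Proof.
move=> hz hW hd; have [u u3 hu] := cube_root_near z W.
exists u.
have nu : 3 / 5 <= nm u.
  have c0 : 0 <= 3 / 5 :> R by lra.
  by rewrite -(cube_le c0 (nm_ge0 _)) -nmX u3; apply: le_trans hW; lra.
(* A crude bound on [z - u] first: it makes [u^2 + u z + z^2] nearly [3 u^2],
   and then [hm] sharpens it. *)
have d1 : nm (z - u) <= 7 / 32.
  have c0 : 0 <= 7 / 32 :> R by lra.
  by rewrite -(cube_le (nm_ge0 _) c0); apply: le_trans hu _; apply: le_trans hd _; lra.
split => //.
have hm : nm (u - z) * (3 * nm u ^+ 2 - 3 * nm u * nm (u - z) - nm (u - z) ^+ 2) <= nm (z ^+ 3 - W).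
  by rewrite -u3 (nmC (z ^+ 3)) cube_sub nmM ler_wpM2l ?nm_ge0// quad_form_ge.
rewrite nmC in d1.
have d0 := nm_ge0 (u - z).
have d2 : nm (u - z) <= 9 / 500.
  have : nm (u - z) * (6 / 10) <= 1 / 96.
    by apply: le_trans hd; apply: le_trans hm; rewrite ler_wpM2l//; nra.
  by lra.
apply: le_trans hm; rewrite mulrC ler_wpM2l//; nra.
Qed.

End Cubes.

(** * The conjugacy between [z^3 + a] and [z^3 + b] *)

Section Expi.
Context {R : realType}.
Implicit Types (s t : R).

Lemma expiD s t : expi (s + t) = expi s * expi t :> CC R.
Proof.
apply/eqP; rewrite eq_complex /= cosD sinD; apply/andP; split; apply/eqP => //.
by rewrite addrC.
Qed.
Lemma expi0 : expi 0 = 1 :> CC R.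
Proof. by rewrite /expi cos0 sin0. Qed.
Lemma nm_expi t : nm (expi t) = 1.
Proof. by rewrite /nm /expi /= cos2Dsin2 sqrtr1. Qed.
Lemma expiMn t n : expi t ^+ n = expi (t *+ n) :> CC R.
Proof. by elim: n => [|n IH]; rewrite ?expr0 ?mulr0n ?expi0// exprS IH mulrS expiD. Qed.
Lemma expiNM t z : expi (- t) * (expi t * z) = z.
Proof. by rewrite mulrA -expiD addNr expi0 mul1r. Qed.
Lemma expi_cont t (e : R) : 0 < e ->
  exists2 d : R, 0 < d & forall s, `|s - t| < d -> nm (expi s - expi t) < e.
Proof.
move=> e0.
have e2 : 0 < e / 2 by rewrite divr_gt0.
have /cvgrPdist_lt/(_ _ e2) /nbhs_ballP[d1 /= d10 h1] := @continuous_cos R t.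
have /cvgrPdist_lt/(_ _ e2) /nbhs_ballP[d2 /= d20 h2] := @continuous_sin R t.
exists (Num.min d1 d2); first by rewrite lt_min d10.
move=> s; rewrite lt_min => /andP[s1 s2].
apply: le_lt_trans (nm_ReIm _) _; rewrite /expi /=.
have H1 : `|cos s - cos t| < e / 2 by rewrite distrC; apply: h1; rewrite /ball /= distrC.
have H2 : `|sin s - sin t| < e / 2 by rewrite distrC; apply: h2; rewrite /ball /= distrC.
lra.
Qed.
End Expi.

(** * The radial twist that starts the iteration *)

Section Twist.
Context {R : realType}.
Implicit Types (a b z w : CC R) (th t : R).

(* 63/125 is |a| + r^3 for r = 3/5 and |a| = 36/125: the disc p(D) lies in the
   region rotated by the full angle.  On |z| = r the angle is divided by 3, so
   that the twist already satisfies the conjugacy equation there. *)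
Definition ramp t : R := Num.max 0 (Num.min 1 (1 - (t - 63 / 125) * (125 / 18))).

Lemma ramp_inner t : t <= 63 / 125 -> ramp t = 1.
Proof.
move=> h; rewrite /ramp min_l; last by lra.
by rewrite max_r.
Qed.
(** This value fixes the slope 125/18: the angle drops by 2/3 between the radii 63/125 and
    75/125. *)
Lemma ramp_r : ramp (3 / 5) = 1 / 3.
Proof. by rewrite /ramp min_r; [rewrite max_r|]; lra. Qed.
Lemma ramp_outer t : 1 <= t -> ramp t = 0.
Proof. by move=> h; rewrite /ramp min_r; [rewrite max_l//|]; lra. Qed.
Lemma ramp_norm t : `|ramp t| <= 1.
Proof.
rewrite ger0_norm; last by rewrite le_max lexx.
by rewrite ge_max ler01 /= ge_min lexx.
Qed.
Lemma rampP t : let x := 1 - (t - 63 / 125) * (125 / 18) in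
  [\/ x <= 0 /\ ramp t = 0, 0 <= x <= 1 /\ ramp t = x | 1 <= x /\ ramp t = 1].
Proof.
move=> x; rewrite /ramp -/x.
have [x1|x1] := leP 1 x; first by apply: Or33; rewrite max_r.
have [x0|x0] := leP 0 x; first by apply: Or32; rewrite (ltW x1).
by apply: Or31; rewrite ltW.
Qed.
Lemma ramp_lip s t : `|ramp s - ramp t| <= 125 / 18 * `|s - t|.
Proof.
have h : 0 <= `|s - t| by [].
have := ler_norm (s - t); have := ler_norm (t - s); rewrite (distrC t s) => h1 h2.
rewrite ler_norml.
by case: (rampP s) => [[c1 ->]|[/andP[c1 c2] ->]|[c1 ->]];
  case: (rampP t) => [[c3 ->]|[/andP[c3 c4] ->]|[c3 ->]]; apply/andP; split; lra.
Qed.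

Definition twist th z : CC R := expi (th * ramp (nm z)) * z.

(** Asked for all fractions of the angle, of either sign, so as to cover every value of [ramp] and
    the inverse twist. *)
Definition small_angle th := forall s, `|s| <= 1 -> nm (expi (th * s) - 1) <= 1 / 1000.

Lemma small_angle_ex : exists th, [/\ small_angle th, 0 < th & th < 1].
Proof.
have [|d d0 hd] := @expi_cont R 0 (1 / 1000); first by lra.
have m0 : 0 < Num.min d 1 by rewrite lt_min d0 ltr01.
exists (Num.min d 1 / 2); split; last 2 first.
- by rewrite divr_gt0.
- have : Num.min d 1 <= 1 by rewrite ge_min lexx orbT.
  by lra.
move=> s s1; rewrite -expi0 ltW// hd// subr0 normrM gtr0_norm ?divr_gt0//.
have : Num.min d 1 <= d by rewrite ge_min lexx.
have := normr_ge0 s; nra.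
Qed.

Lemma small_angleN th : small_angle th -> small_angle (- th).
Proof. by move=> h s s1; rewrite mulNr -mulrN; apply: h; rewrite normrN. Qed.

Lemma nm_twist th z : nm (twist th z) = nm z.
Proof. by rewrite nmM nm_expi mul1r. Qed.
Lemma twistK th z : twist (- th) (twist th z) = z.
Proof. by rewrite {1}/twist nm_twist mulNr expiNM. Qed.
Lemma twist_inner th z : nm z <= 63 / 125 -> twist th z = expi th * z.
Proof. by move=> h; rewrite /twist ramp_inner ?mulr1. Qed.
Lemma twist_r th z : nm z = 3 / 5 -> twist th z = expi (th / 3) * z.
Proof. by move=> h; rewrite /twist h ramp_r mul1r. Qed.
Lemma twist_equiv th o z : o ^+ 3 = 1 -> twist th (o * z) = o * twist th z.
Proof. by move=> o3; rewrite /twist nmM (unity3_nm o3) mul1r mulrCA. Qed.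
Lemma twist_near th z : small_angle th -> nm (twist th z - z) <= 1 / 1000 * Num.min 1 (nm z).
Proof.
move=> sa; have [z1|z1] := leP 1 (nm z).
  by rewrite /twist ramp_outer// mulr0 expi0 mul1r subrr nm0 mulr1; lra.
rewrite (_ : _ - _ = (expi (th * ramp (nm z)) - 1) * z); last by rewrite /twist mulrBl mul1r.
by rewrite nmM ler_wpM2r ?nm_ge0// sa// ramp_norm.
Qed.
Lemma twist_near1 th z : small_angle th -> nm (twist th z - z) <= 1 / 1000.
Proof.
move=> sa; apply: le_trans (twist_near z sa) _.
by have : Num.min 1 (nm z) <= 1; [rewrite ge_min lexx|lra].
Qed.
Lemma twist_cont th z : cont_at (twist th) z.
Proof.
apply: cont_atM; last exact: cont_at_id.
move=> e e0; have [d d0 hd] := expi_cont (th * ramp (nm z)) e0.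
pose M := `|th| * (125 / 18) + 1.
have M0 : 0 < M by rewrite ltr_wpDl// mulr_ge0// divr_ge0.
exists (d / M); first by rewrite divr_gt0.
move=> w hw; apply: hd; rewrite -mulrBr normrM.
have h1 := ramp_lip (nm w) (nm z).
have h2 : `|nm w - nm z| <= nm (w - z).
  rewrite ler_norml nm_sub andbT lerNl opprB nmC; exact: nm_sub.
rewrite ltr_pdivlMr// in hw; apply: le_lt_trans hw.
have := normr_ge0 th; have := nm_ge0 (w - z).
have : `|th| * `|ramp (nm w) - ramp (nm z)| <= `|th| * (125 / 18 * nm (w - z)).
  by rewrite ler_wpM2l//; lra.
rewrite /M; lra.
Qed.
End Twist.

(** * One pullback step and the properties it preserves *)

Section Step.
Context {R : realType}.
Implicit Types (a b z w u om : CC R) (th t e : R) (h k : CC R -> CC R).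

Definition cub a z : CC R := z ^+ 3 + a.

(* The union of the images of p(D), D the disc of radius 3/5, under the
   rotations by cube roots of unity. *)
Definition in_petal a z := exists om u, [/\ om ^+ 3 = 1, nm u <= 3 / 5 & z = om * cub a u].

Record good_pair a b th : Prop := GoodPair {
  gp_nm : nm a = 36 / 125;
  gp_rot : b = expi th * a;
  gp_small : small_angle th }.

(* [h'] solves [h' \o p = q \o h] on the petals, where q contracts, and
   [h \o p = q \o h'] outside D, where q expands; on the rest of D nothing is
   imposed by the dynamics and the twist is kept. *)
Record pullback_step a b th h h' : Prop := PullbackStep {
  ps_outer : forall z, 3 / 5 <= nm z ->
    h' z ^+ 3 = h (cub a z) - b /\ nm (h' z - z) <= 1 / 101;
  ps_petal : forall om u, om ^+ 3 = 1 -> nm u <= 3 / 5 -> nm (om * cub a u) < 3 / 5 ->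
    h' (om * cub a u) = om * cub b (h u);
  ps_free : forall z, nm z < 3 / 5 -> ~ in_petal a z -> h' z = twist th z }.

(** The disc [nm (z - a) <= 27 / 125] is p(D). Mapping its exterior to the exterior of q(D) keeps
    the cube roots of [h (cub a z) - b] outside D; [inv_equiv] makes the inner formula independent
    of the preimage; [inv_ball_eq] and [inv_free] fix the boundary values used for gluing. *)
Record invariant a b th h : Prop := Invariant {
  inv_cont : forall z, cont_at h z;
  inv_near : forall z, nm (h z - z) <= 1 / 100;
  inv_equiv : forall om z, om ^+ 3 = 1 -> h (om * z) = om * h z;
  inv_ge : forall z, 3 / 5 <= nm z -> 3 / 5 <= nm (h z);
  inv_le : forall z, nm z <= 3 / 5 -> nm (h z) <= 3 / 5;
  inv_ball_le : forall z, nm (z - a) <= 27 / 125 -> nm (h z - b) <= 27 / 125;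
  inv_ball_ge : forall z, 27 / 125 <= nm (z - a) -> 27 / 125 <= nm (h z - b);
  inv_ball_eq : forall z, nm (z - a) = 27 / 125 -> h z = expi th * z;
  inv_free : forall z, nm z <= 3 / 5 -> ~ in_petal a z -> h z = twist th z }.

Lemma good_pair_sym a b th : good_pair a b th -> good_pair b a (- th).
Proof.
move=> [na -> sa]; split; last exact: small_angleN.
  by rewrite nmM nm_expi mul1r.
by rewrite expiNM.
Qed.

Lemma unity3_eq u w : u ^+ 3 = w ^+ 3 -> exists2 om, om ^+ 3 = 1 & u = om * w.
Proof.
move=> e; have [w0|w0] := eqVneq w 0.
  exists 1; rewrite ?expr1n// w0 mulr0; apply/eqP.
  by have /eqP := e; rewrite w0 expr0n /= expf_eq0.
by exists (u / w); rewrite ?divfK// exprMn exprVn e divff// expf_neq0.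
Qed.

Section Fixed.
Variables (a b : CC R) (th : R).
Hypothesis gp : good_pair a b th.

Let na : nm a = 36 / 125 := gp_nm gp.
Let nb : nm b = 36 / 125 := gp_nm (good_pair_sym gp).
Let sa : small_angle th := gp_small gp.
Let eb : b = expi th * a := gp_rot gp.

Lemma nm_ba : nm (b - a) <= 1 / 1000 * (36 / 125).
Proof.
rewrite eb (_ : _ - _ = (expi th - 1) * a); last by rewrite mulrBl mul1r.
rewrite nmM na; have := sa (s := 1); rewrite normr1 mulr1 => /(_ (lexx _)); lra.
Qed.

Lemma cube_r u : nm u <= 3 / 5 -> nm u ^+ 3 <= 27 / 125.
Proof.
move=> h; have c0 : 0 <= 3 / 5 :> R by lra.
by move: h; rewrite -(cube_le (nm_ge0 _) c0); lra.
Qed.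
Lemma cube_r_ge u : 3 / 5 <= nm u -> 27 / 125 <= nm u ^+ 3.
Proof.
move=> h; have c0 : 0 <= 3 / 5 :> R by lra.
by move: h; rewrite -(cube_le c0 (nm_ge0 _)); lra.
Qed.
Lemma r_cube u : nm u ^+ 3 <= 27 / 125 -> nm u <= 3 / 5.
Proof.
move=> h; have c0 : 0 <= 3 / 5 :> R by lra.
by rewrite -(cube_le (nm_ge0 _) c0); lra.
Qed.
Lemma r_cube_ge u : 27 / 125 <= nm u ^+ 3 -> 3 / 5 <= nm u.
Proof.
move=> h; have c0 : 0 <= 3 / 5 :> R by lra.
by rewrite -(cube_le c0 (nm_ge0 _)); lra.
Qed.

Lemma cubK u : cub a u - a = u ^+ 3. Proof. by rewrite /cub addrK. Qed.

Lemma ball_cub z : nm (z - a) <= 27 / 125 -> exists2 u, nm u <= 3 / 5 & z = cub a u.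
Proof.
move=> h; have [u hu] := cube_root_ex (z - a).
exists u; last by rewrite /cub hu subrK.
by apply: r_cube; rewrite -nmX hu.
Qed.

Lemma petal_nm z : in_petal a z -> nm z <= 63 / 125.
Proof.
move=> [om [u [om3 hu ->]]]; rewrite nmM (unity3_nm om3) mul1r.
apply: le_trans (nmD _ _) _; rewrite nmX na; have := cube_r hu; lra.
Qed.

Lemma petal_lt om u : om ^+ 3 = 1 -> nm u <= 3 / 5 -> nm (om * cub a u) < 3 / 5.
Proof.
move=> om3 hu; have := @petal_nm (om * cub a u).
have : in_petal a (om * cub a u) by exists om, u.
by move=> h /(_ h); lra.
Qed.

Lemma petal_rot om z : om ^+ 3 = 1 -> in_petal a (om * z) -> in_petal a z.
Proof.
move=> om3 [p [u [p3 hu e]]]; exists (om ^+ 2 * p), u; split => //.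
  by rewrite exprMn (unity3_sqr om3) mul1r.
by rewrite -mulrA -e mulrA -exprSr om3 mul1r.
Qed.

(** Centres of different petals are [sqrt 3 * (36 / 125)] apart, about 0.499, while the two radii
    add up to 54/125 = 0.432. The gap exceeds 6/100; continuity on the petals relies on its being
    positive. *)
Lemma petal_same om u p v : om ^+ 3 = 1 -> p ^+ 3 = 1 -> nm u <= 3 / 5 -> nm v <= 3 / 5 ->
  nm (om * cub a u - p * cub a v) <= 6 / 100 -> om = p.
Proof.
move=> om3 p3 hu hv hd; apply/eqP; apply: contraT => op.
have p0 : p != 0.
  by apply/eqP => h; move: p3; rewrite h expr0n /= => /eqP; rewrite eq_sym oner_eq0.
have q3 : (om / p) ^+ 3 = 1 by rewrite exprMn exprVn om3 p3 divr1.
have q1 : om / p != 1 by apply: contra op => /eqP h; rewrite -[om](divfK p0) h mul1r.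
have q := unity3_dist q3 q1.
have e : nm (om - p) = nm (om / p - 1).
  by rewrite -[RHS]mulr1 -(unity3_nm p3) -nmM mulrBl mul1r divfK.
have : nm (om - p) * nm a <= nm (om * cub a u - p * cub a v) + (nm u ^+ 3 + nm v ^+ 3).
  rewrite -nmM (_ : (om - p) * a = (om * cub a u - p * cub a v) - (om * u ^+ 3 - p * v ^+ 3)); last by rewrite /cub; ring.
  apply: le_trans (nmB _ _) _; rewrite lerD2l; apply: le_trans (nmB _ _) _.
  by rewrite (nmM om) (nmM p) !nmX (unity3_nm om3) (unity3_nm p3) !mul1r.
have := cube_r hu; have := cube_r hv; rewrite na e => h1 h2 h3.
have := nm_ge0 (om / p - 1); nra.
Qed.

Lemma petal_uniq om u p v : om ^+ 3 = 1 -> p ^+ 3 = 1 -> nm u <= 3 / 5 -> nm v <= 3 / 5 ->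
  om * cub a u = p * cub a v -> om = p /\ u ^+ 3 = v ^+ 3.
Proof.
move=> om3 p3 hu hv e.
have op : om = p by apply: (petal_same om3 p3 hu hv); rewrite e subrr nm0; lra.
have o0 : om != 0.
  by apply/eqP => h; move: om3; rewrite h expr0n /= => /eqP; rewrite eq_sym oner_eq0.
split => //; move: e; rewrite -op => /(mulfI o0); rewrite /cub; exact: addIr.
Qed.

Lemma inv_r h z : invariant a b th h -> nm z = 3 / 5 -> h z = expi (th / 3) * z.
Proof.
move=> I hz; rewrite (inv_free I) ?hz ?twist_r// => /petal_nm; rewrite hz; lra.
Qed.

Lemma inv_petal h z : invariant a b th h -> in_petal a z -> nm (h z) <= 63 / 125.
Proof.
move=> I [om [u [om3 hu ->]]]; rewrite (inv_equiv I)// nmM (unity3_nm om3) mul1r.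
have := @inv_ball_le _ _ _ _ I (cub a u); rewrite cubK nmX => /(_ (cube_r hu)).
have := nm_add (h (cub a u)) (- b); rewrite nmN nb; lra.
Qed.

Lemma invariant0 : invariant a b th (twist th).
Proof.
split.
- exact: twist_cont.
- by move=> z; have := twist_near1 z sa; lra.
- by move=> om z; exact: twist_equiv.
- by move=> z; rewrite nm_twist.
- by move=> z; rewrite nm_twist.
- move=> z hz; rewrite twist_inner; first by rewrite eb -mulrBr nmM nm_expi mul1r.
  by have := nm_sub z a; rewrite na; lra.
- move=> z hz; have [z1|z1] := leP (nm z) (63 / 125).
    by rewrite twist_inner// eb -mulrBr nmM nm_expi mul1r.
  by have := nm_sub (twist th z) b; rewrite nm_twist nb; lra.
- move=> z hz; rewrite twist_inner//.
  by have := nm_sub z a; rewrite na; lra.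
- by [].
Qed.

(** The three prescriptions concern disjoint regions, so a value can be chosen point by point. Only
    on the petals is there something to check: another preimage differs by a cube root of unity,
    which [inv_equiv] turns into the same value of [cub b (h u)]. *)
Lemma step_ex h : invariant a b th h -> exists h', pullback_step a b th h h'.
Proof.
move=> I.
have /(_ _)/cid hz : forall z, exists y,
   [/\ 3 / 5 <= nm z -> y ^+ 3 = h (cub a z) - b /\ nm (y - z) <= 1 / 101,
     forall om u, om ^+ 3 = 1 -> nm u <= 3 / 5 -> nm z < 3 / 5 -> z = om * cub a u -> y = om * cub b (h u)
   & nm z < 3 / 5 -> ~ in_petal a z -> y = twist th z].
  move=> z; have [z1|z1] := leP (3 / 5) (nm z).
    have [||u [u1 u2 u3]] := @cube_root_lift _ z (h (cub a z) - b) z1.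
    - by apply: (inv_ball_ge I); rewrite cubK nmX cube_r_ge.
    - rewrite (_ : _ - _ = (b - a) - (h (cub a z) - cub a z)); last by rewrite /cub; ring.
      have := nmB (b - a) (h (cub a z) - cub a z); have := inv_near I (cub a z).
      have := nm_ba; lra.
    exists u; split => // _; split => //.
    have : nm (z ^+ 3 - (h (cub a z) - b)) <= 1 / 100 + 1 / 1000 * (36 / 125).
      rewrite (_ : _ - _ = (b - a) - (h (cub a z) - cub a z)); last by rewrite /cub; ring.
      have := nmB (b - a) (h (cub a z) - cub a z); have := inv_near I (cub a z).
      have := nm_ba; lra.
    lra.
  have [[p [v [p3 hv e]]]|np] := pselect (in_petal a z); last first.
    exists (twist th z); split => //.
    by move=> om u om3 hu _ e; case: np; exists om, u.
  exists (p * cub b (h v)); split.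
  - by [].
  - move=> om u om3 hu _ e'; have [->] := petal_uniq p3 om3 hv hu (etrans (esym e) e').
    by move=> /unity3_eq[q q3 ->]; rewrite (inv_equiv I)// /cub exprMn q3 mul1r.
  - by move=> _ []; exists p, v.
exists (fun z => sval (hz z)); split.
- by move=> z; case: (hz z) => y /= [].
- by move=> om u om3 hu lt; case: (hz _) => y /= [_ h1 _]; exact: h1.
- by move=> z; case: (hz z) => y /= [].
Qed.

Lemma outer_ge h h' z : invariant a b th h -> pullback_step a b th h h' ->
  3 / 5 <= nm z -> 3 / 5 <= nm (h' z).
Proof.
move=> I S hz; have [e _] := ps_outer S hz.
apply: r_cube_ge; rewrite -nmX e; apply: (inv_ball_ge I).
by rewrite cubK nmX cube_r_ge.
Qed.

(** Two cube roots of the same number within 1/50 of each other coincide outside D. This identifies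
    [h' z] with an explicit candidate: the twist on the circle, the rotated value for equivariance,
    the original point for inverses. *)
Lemma outer_uniq h h' z y : invariant a b th h -> pullback_step a b th h h' ->
  3 / 5 <= nm z -> y ^+ 3 = h (cub a z) - b -> nm (y - z) <= 1 / 100 -> h' z = y.
Proof.
move=> I S hz ey ny; have [e n] := ps_outer S hz.
apply: cube_inj_near; [exact: (outer_ge I S)| |by rewrite e].
have := nm_tri z (h' z) y; rewrite (nmC z y); lra.
Qed.

(* On |z| = r the lift is the twist, so the pieces of [h'] fit together. *)
Lemma step_r h h' z : invariant a b th h -> pullback_step a b th h h' ->
  nm z = 3 / 5 -> h' z = twist th z.
Proof.
move=> I S hz.
apply: (outer_uniq I S).
- by rewrite hz.
- rewrite twist_r// (inv_ball_eq I); last first.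
    by rewrite cubK nmX hz; lra.
  rewrite exprMn expiMn /cub mulrDr -eb addrK; congr (expi _ * _).
  by rewrite -mulr_natr; field.
- have := twist_near1 z sa; lra.
Qed.

Lemma step_free h h' z : invariant a b th h -> pullback_step a b th h h' ->
  nm z <= 3 / 5 -> ~ in_petal a z -> h' z = twist th z.
Proof.
move=> I S; rewrite le_eqVlt => /orP[/eqP hz _|]; first exact: (step_r I S).
exact: (ps_free S).
Qed.

Lemma step_petal h h' om u : pullback_step a b th h h' -> om ^+ 3 = 1 -> nm u <= 3 / 5 ->
  h' (om * cub a u) = om * cub b (h u).
Proof. by move=> S om3 hu; apply: (ps_petal S) => //; exact: petal_lt. Qed.

(** The rate is [3 * (63 / 125) ^ 2 < 77 / 100]. *)
Lemma cube_contract u v : nm u <= 63 / 125 -> nm v <= 63 / 125 ->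
  nm (u ^+ 3 - v ^+ 3) <= 77 / 100 * nm (u - v).
Proof.
move=> hu hv; rewrite cube_sub nmM mulrC ler_wpM2r ?nm_ge0//.
apply: le_trans (quad_form_le u v) _.
have := nm_ge0 u; have := nm_ge0 v; nra.
Qed.

Lemma twist_cube_near u : nm u <= 3 / 5 -> nm (twist th u ^+ 3 - u ^+ 3) <= 2 / 1000.
Proof.
move=> hu; rewrite cube_sub nmM.
have h1 := twist_near1 u sa; have h2 := quad_form_le (twist th u) u.
rewrite nm_twist in h2.
have : nm (twist th u ^+ 2 + twist th u * u + u ^+ 2) <= 2.
  by have := nm_ge0 u; nra.
have := nm_ge0 (twist th u - u); nra.
Qed.

(** On a petal the contraction reduces 1/100 to 77/10000 and leaves room for [b - a]; elsewhere in
    D, [h] is still the twist, whose error is far smaller. *)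
Lemma cub_near h u : invariant a b th h -> nm u <= 3 / 5 -> nm (cub b (h u) - cub a u) <= 1 / 100.
Proof.
move=> I hu.
rewrite (_ : _ - _ = (h u ^+ 3 - u ^+ 3) + (b - a)); last by rewrite /cub; ring.
apply: le_trans (nmD _ _) _; have := nm_ba.
have [p|p] := pselect (in_petal a u).
  have := cube_contract (inv_petal I p) (petal_nm p); have := inv_near I u; lra.
rewrite (inv_free I)//; have := twist_cube_near hu; lra.
Qed.

Lemma nm_cub_le u : nm u <= 3 / 5 -> nm (cub b u) <= 63 / 125.
Proof.
move=> hu; apply: le_trans (nmD _ _) _; rewrite nmX nb; have := cube_r hu; lra.
Qed.

Lemma ball_in_petal z : nm (z - a) <= 27 / 125 -> in_petal a z.
Proof.
by move=> /ball_cub[u hu ->]; exists 1, u; split; rewrite ?expr1n ?mul1r.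
Qed.

Lemma inv_step_cont_outer h h' z0 e : invariant a b th h -> pullback_step a b th h h' ->
  0 < e -> exists2 d, 0 < d &
  forall z, 3 / 5 <= nm z -> nm (z - z0) < d -> nm (h' z - h' z0) < e.
Proof.
move=> I S e0; have [z1|z1] := leP (3 / 5) (nm z0); last first.
  exists (3 / 5 - nm z0); first by lra.
  by move=> z hz hd; have := nm_sub z z0; lra.
have : cont_at (h \o cub a) z0.
  apply: cont_at_comp (inv_cont I _); apply: cont_atD; [apply: cont_atX; exact: cont_at_id|exact: cont_at_cst].
move=> /(_ e e0)[d d0 hd].
(* Here [2 / 101 + 1 / 6400 < 1 / 50]: the images stay in the range of [cube_expand]. This slack is
   the reason for 1/101 in [ps_outer]. *)
exists (Num.min d (1 / 80 * (1 / 80))); first by rewrite lt_min d0; lra.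
move=> z hz; rewrite lt_min => /andP[/hd /= h1 h2].
have [e1 n1] := ps_outer S hz; have [e2 n2] := ps_outer S z1.
have n3 : nm (h' z - h' z0) <= 1 / 50.
  have := nm_tri z (h' z) (h' z0); have := nm_tri z0 z (h' z0).
  rewrite (nmC z0 (h' z0)); lra.
have := cube_expand (outer_ge I S hz) n3.
rewrite e1 e2 (_ : _ - _ - _ = h (cub a z) - h (cub a z0)); last by ring.
have := nm_ge0 (h' z - h' z0); lra.
Qed.

Lemma inv_step_cont_petal h h' z0 e : invariant a b th h -> pullback_step a b th h h' ->
  0 < e -> in_petal a z0 -> exists2 d, 0 < d &
  forall z, in_petal a z -> nm (z - z0) < d -> nm (h' z - h' z0) < e.
Proof.
move=> I S e0 [om [u0 [om3 hu0 ->]]].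
have [d d0 hd] := cont_atX 3 (inv_cont I u0) e0.
(* The bound 6/100 forces both points into the same petal. A preimage of the nearby point need not
   be near [u0], but some preimage [v] satisfies [nm (u0 - v) ^+ 3 <= nm (u0 ^+ 3 - u ^+ 3)], hence
   the cube. *)
exists (Num.min (d ^+ 3) (6 / 100)); first by rewrite lt_min exprn_gt0//; lra.
move=> _ [p [u [p3 hu ->]]]; rewrite lt_min => /andP[h1 h2].
have e1 := petal_same p3 om3 hu hu0 (ltW h2); rewrite -{}e1 in h1 h2 *.
have [v v3 nv] := cube_root_near u0 (u ^+ 3).
have [q q3 uv] := unity3_eq (esym v3).
have hv : nm v <= 3 / 5 by move: hu; rewrite uv nmM unity3_nm ?mul1r.
have cu : cub a u = cub a v by rewrite /cub v3.
rewrite cu !(step_petal S)// -mulrBr nmM unity3_nm// mul1r.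
rewrite (_ : _ - _ = h v ^+ 3 - h u0 ^+ 3); last by rewrite /cub; ring.
apply: hd; rewrite nmC ltNge; apply/negP => dv.
move: h1; rewrite -mulrBr nmM unity3_nm// mul1r ltNge => /negP; apply.
rewrite (_ : cub a u - _ = - (u0 ^+ 3 - u ^+ 3)); last by rewrite /cub; ring.
by rewrite nmN; apply: le_trans nv; rewrite cube_le ?nm_ge0// ltW.
Qed.

(** Gluing along the inner boundary: on [nm u = 3 / 5] the map [h] is the rotation by th/3, which
    [cub] turns into the rotation by th, the value of the twist on the petal. *)
Lemma petal_bound_free h h' om u : invariant a b th h -> pullback_step a b th h h' ->
  om ^+ 3 = 1 -> nm u = 3 / 5 -> h' (om * cub a u) = twist th (om * cub a u).
Proof.
move=> I S om3 hu; have hu' : nm u <= 3 / 5 by rewrite hu.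
rewrite (step_petal S)// twist_equiv// twist_inner; last first.
  apply: petal_nm; exists 1, u; split; rewrite ?expr1n ?mul1r//.
congr (_ * _); rewrite (inv_r I)// /cub exprMn expiMn mulrDr -eb; congr (expi _ * _ + _).
by rewrite -mulr_natr; field.
Qed.

Lemma unity3_list : exists s : seq (CC R), forall om, (om ^+ 3 = 1) <-> (om \in s).
Proof.
have [w hw w3] := @unity3_ex R.
exists [:: 1; w; w ^+ 2] => om; rewrite !inE; split; last first.
  move=> /or3P[] /eqP ->; rewrite ?expr1n//.
  exact: unity3_sqr.
move=> om3; have : (om - 1) * (om - w) * (om - w ^+ 2) = 0.
  transitivity (om ^+ 3 - 1 + ((w ^+ 2 + w + 1) * (w * om - om ^+ 2) - (w ^+ 3 - 1))).
    by ring.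
  by rewrite om3 hw w3 !subrr mul0r subrr addr0.
by move=> /eqP; rewrite !mulf_eq0 !subr_eq0 orbA.
Qed.

Lemma seq_min_gt0 (s : seq (CC R)) (g : CC R -> R) : (forall om, om \in s -> 0 < g om) ->
  exists2 d, 0 < d & forall om, om \in s -> d <= g om.
Proof.
elim: s => [|om s IH] hg; first by exists 1.
have [|d d0 hd] := IH; first by move=> p ps; apply: hg; rewrite inE ps orbT.
exists (Num.min d (g om)); first by rewrite lt_min d0 hg// inE eqxx.
by move=> p; rewrite inE ge_min => /orP[/eqP ->|/hd ->]//; rewrite lexx orbT.
Qed.

(** The union of the petals is closed, being a union of three closed discs. *)
Lemma petal_far z0 : ~ in_petal a z0 -> exists2 d, 0 < d &
  forall z, nm (z - z0) < d -> ~ in_petal a z.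
Proof.
move=> np; have [s hs] := unity3_list.
have [|d d0 hd] := @seq_min_gt0 s (fun om => nm (om * z0 - a) - 27 / 125).
  move=> om /hs om3; rewrite subr_gt0 ltNge; apply/negP.
  by move=> /ball_in_petal /(petal_rot om3); exact: np.
exists d => // z hz [om [u [om3 hu e]]].
have p3 := unity3_sqr om3.
have e' : om ^+ 2 * z = cub a u by rewrite e mulrA -exprSr om3 mul1r.
have := hd _ (iffLR (hs _) p3); have := nm_tri (om ^+ 2 * z) (om ^+ 2 * z0) a.
rewrite -mulrBr nmM (unity3_nm p3) mul1r (nmC z0) e' cubK nmX.
have := cube_r hu; lra.
Qed.

(** Nearby points are sorted by region. In the free region the comparison is with the twist; if
    [h' z0] differs from the twist at [z0], then [z0] is outside the closed disc or interior to a
    petal, and no free point is near it. *)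
Lemma step_cont h h' z0 : invariant a b th h -> pullback_step a b th h h' -> cont_at h' z0.
Proof.
move=> I S e e0.
have [d1 d10 hd1] := inv_step_cont_outer z0 I S e0.
have [d2 d20 hd2] : exists2 d, 0 < d &
    forall z, in_petal a z -> nm (z - z0) < d -> nm (h' z - h' z0) < e.
  have [p|/petal_far[d d0 hd]] := pselect (in_petal a z0).
    exact: inv_step_cont_petal I S e0 p.
  by exists d => // z pz /hd.
have [d3 d30 hd3] : exists2 d, 0 < d &
    forall z, nm z < 3 / 5 -> ~ in_petal a z -> nm (z - z0) < d -> nm (h' z - h' z0) < e.
  have [e3|ne3] := pselect (h' z0 = twist th z0).
    have [d d0 hd] := twist_cont th z0 e0.
    by exists d => // z z1 np /hd; rewrite (ps_free S z1 np) e3.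
  have [z1|z1] := ltP (3 / 5) (nm z0).
    exists (nm z0 - 3 / 5); first by rewrite subr_gt0.
    by move=> z hz _ hd; have := nm_sub z0 z; rewrite nmC; lra.
  have [[om [u [om3 hu ez0]]]|np] := pselect (in_petal a z0); last first.
    by case: ne3; exact: (step_free I S).
  have [hu1|hu1] := eqVneq (nm u) (3 / 5).
    by case: ne3; rewrite ez0 (petal_bound_free I S).
  have hu2 : nm u < 3 / 5 by rewrite lt_neqAle hu1.
  have hu3 : nm u ^+ 3 < 27 / 125.
    have c0 : 0 <= 3 / 5 :> R by lra.
    by have := ltrXn2r 3 (nm_ge0 u) hu2 => /=; lra.
  exists (27 / 125 - nm u ^+ 3); first by rewrite subr_gt0.
  move=> z _ np hd; case: np.
  apply: (@petal_rot (om ^+ 2)); first exact: unity3_sqr.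
  apply: ball_in_petal.
  have e' : om ^+ 2 * z0 = cub a u by rewrite ez0 mulrA -exprSr om3 mul1r.
  have := nm_tri (om ^+ 2 * z0) (om ^+ 2 * z) a.
  by rewrite -mulrBr nmM e' nmX (unity3_nm om3) expr1n mul1r cubK nmX; lra.
exists (Num.min d1 (Num.min d2 d3)); first by rewrite !lt_min d10 d20.
move=> z; rewrite !lt_min => /and3P[h1 h2 h3].
have [z1|z1] := leP (3 / 5) (nm z); first exact: hd1.
have [p|p] := pselect (in_petal a z); first exact: hd2.
exact: hd3.
Qed.

Lemma invariant_step h h' : invariant a b th h -> pullback_step a b th h h' ->
  invariant a b th h'.
Proof.
move=> I S; split.
- by move=> z; exact: step_cont I S.
- move=> z; have [z1|z1] := leP (3 / 5) (nm z).
    by have [_] := ps_outer S z1; lra.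
  have [[om [u [om3 hu ->]]]|np] := pselect (in_petal a z).
    by rewrite (step_petal S)// -mulrBr nmM (unity3_nm om3) mul1r; exact: cub_near I hu.
  by rewrite (ps_free S)//; have := twist_near1 z sa; lra.
- move=> om z om3; have [z1|z1] := leP (3 / 5) (nm z).
    have [e n] := ps_outer S z1.
    apply: (outer_uniq I S); first by rewrite nmM (unity3_nm om3) mul1r.
      by rewrite exprMn om3 mul1r e /cub exprMn om3 mul1r.
    by rewrite -mulrBr nmM (unity3_nm om3) mul1r; lra.
  have [[p [u [p3 hu ->]]]|np] := pselect (in_petal a z).
    by rewrite mulrA !(step_petal S)// ?mulrA// exprMn om3 p3 mul1r.
  have z2 : nm (om * z) < 3 / 5 by rewrite nmM (unity3_nm om3) mul1r.
  have np2 : ~ in_petal a (om * z) by move=> /(petal_rot om3).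
  by rewrite (ps_free S z1 np) (ps_free S z2 np2) twist_equiv.
- by move=> z; exact: outer_ge I S.
- move=> z; rewrite le_eqVlt => /orP[/eqP z1|z1].
    by rewrite (step_r I S z1) nm_twist z1.
  have [[om [u [om3 hu ->]]]|np] := pselect (in_petal a z).
    rewrite (step_petal S)// nmM (unity3_nm om3) mul1r.
    by have := nm_cub_le (inv_le I hu); lra.
  by rewrite (ps_free S)// nm_twist ltW.
- move=> z /ball_cub[u hu ->]; rewrite -[cub a u]mul1r (step_petal S)// ?expr1n//.
  by rewrite mul1r /cub addrK nmX; apply: cube_r; exact: (inv_le I).
- move=> z hz; have [z1|z1] := leP (3 / 5) (nm z).
    have := outer_ge I S z1; have := nm_sub (h' z) b; rewrite nb; lra.
  have [[om [u [om3 hu ez]]]|np] := pselect (in_petal a z).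
    rewrite ez (step_petal S)//.
    have [om1|om1] := eqVneq om 1.
      move: hz; rewrite ez om1 !mul1r cubK nmX /cub addrK nmX => hz.
      by apply: cube_r_ge; apply: (inv_ge I); exact: r_cube_ge.
    (* A different petal stays outside q(D), since [sqrt 3 * (36 / 125) - 27 / 125 > 27 / 125]. *)
    rewrite (_ : om * _ - b = (om - 1) * b + om * h u ^+ 3); last by rewrite /cub; ring.
    have := nm_add ((om - 1) * b) (om * h u ^+ 3).
    rewrite !(nmM, nmX) (unity3_nm om3) mul1r nb.
    have := cube_r (inv_le I hu); have := unity3_dist om3 om1.
    have := nm_ge0 (om - 1); nra.
  rewrite (ps_free S)//; exact: (inv_ball_ge invariant0).
- move=> z hz; have hz' : nm (z - a) <= 27 / 125 by rewrite hz.
  have [u hu ez] := ball_cub hz'.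
  have hu' : nm u = 3 / 5.
    apply/eqP; rewrite eq_le hu /=; apply: r_cube_ge; move: hz; rewrite ez cubK nmX => ->.
    exact: lexx.
  rewrite ez -[cub a u]mul1r (petal_bound_free I S) ?expr1n//.
  rewrite mul1r twist_inner//; apply: petal_nm; exists 1, u; rewrite expr1n mul1r; split => //.
- by move=> z; exact: step_free I S.
Qed.

(** The rate 25/26 is inverse to the expansion outside D. On the petals it is 77/100 if [u] is
    itself in a petal, and otherwise [h u = k u]; in the free region both maps are the twist. *)
Lemma step_contract h h' k k' e : invariant a b th h -> pullback_step a b th h h' ->
  invariant a b th k -> pullback_step a b th k k' ->
  (forall z, nm (h z - k z) <= e) -> forall z, nm (h' z - k' z) <= 25 / 26 * e.
Proof.
move=> I S J T hk z.
have e0 : 0 <= e by apply: le_trans (nm_ge0 _) (hk 0).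
have [z1|z1] := leP (3 / 5) (nm z).
  have [e1 n1] := ps_outer S z1; have [e2 n2] := ps_outer T z1.
  have n3 : nm (h' z - k' z) <= 1 / 50.
    have := nm_tri z (h' z) (k' z); rewrite (nmC z (k' z)); lra.
  have := cube_expand (outer_ge I S z1) n3.
  rewrite e1 e2 (_ : _ - _ - _ = h (cub a z) - k (cub a z)); last by ring.
  have := hk (cub a z); lra.
have [[om [u [om3 hu ->]]]|np] := pselect (in_petal a z); last first.
  rewrite (ps_free S)// (ps_free T)// subrr nm0; lra.
rewrite (step_petal S)// (step_petal T)// -mulrBr nmM (unity3_nm om3) mul1r.
rewrite (_ : _ - _ = h u ^+ 3 - k u ^+ 3); last by rewrite /cub; ring.
have [p|p] := pselect (in_petal a u).
  have := cube_contract (inv_petal I p) (inv_petal J p); have := hk u; lra.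
rewrite (inv_free I)// (inv_free J)// subrr nm0; lra.
Qed.

End Fixed.

(** Each region of the step for [h] goes to the corresponding region of the step for [k], so the
    inverse relation is pulled back along with the maps. *)
Lemma step_inverse a b th h h' k k' : good_pair a b th ->
  invariant a b th h -> pullback_step a b th h h' ->
  invariant b a (- th) k -> pullback_step b a (- th) k k' ->
  cancel h k -> cancel h' k'.
Proof.
move=> gp I S J T hk z; have gp' := good_pair_sym gp.
have [z1|z1] := leP (3 / 5) (nm z).
  have [e1 n1] := ps_outer S z1.
  apply: (outer_uniq J T); first exact: (outer_ge I S).
    by rewrite [cub b _]/cub e1 subrK hk /cub addrK.
  by rewrite nmC; lra.
have [[om [u [om3 hu ->]]]|np] := pselect (in_petal a z).
  by rewrite (step_petal gp S)// (step_petal gp' T) ?hk//; exact: (inv_le I).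
rewrite (ps_free S)// (ps_free T) ?twistK ?nm_twist// => -[om [u [om3 hu e]]].
(* The twist turns a point with preimage [u] under [cub b] back by th, that is, its preimage back by
   th/3. *)
case: np; exists om, (expi (- th / 3) * u); split => //.
  by rewrite nmM nm_expi mul1r.
have hz : nm (twist th z) <= 63 / 125 by apply: (petal_nm gp'); exists om, u.
rewrite -(twistK th z) twist_inner// e mulrCA; congr (_ * _).
rewrite /cub mulrDr exprMn expiMn (gp_rot gp'); congr (expi _ * _ + _).
by rewrite -mulr_natr; field.
Qed.

End Step.

(** * The limit of the pullbacks *)

Section Conjugacy.
Context {R : realType}.
Implicit Types (a b z w u : CC R) (th e : R) (h k : CC R -> CC R).

Lemma cub_cont a z : cont_at (cub a) z.
Proof. by apply: cont_atD; [apply: cont_atX; exact: cont_at_id|exact: cont_at_cst]. Qed.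

Lemma uniform_limit_cont (s : nat -> CC R -> CC R) h :
  (forall n z, cont_at (s n) z) ->
  (forall e, 0 < e -> exists N, forall z, nm (s N z - h z) < e) ->
  forall z, cont_at h z.
Proof.
move=> cs hu z e e0; have [|N hN] := hu (e / 3); first by rewrite divr_gt0.
have [|d d0 hd] := cs N z (e / 3); first by rewrite divr_gt0.
exists d => // w /hd h1; have := hN w; have := hN z.
have := nm_tri (s N w) (h w) (h z); have := nm_tri (s N z) (s N w) (h z).
rewrite (nmC (h w) (s N w)); lra.
Qed.

Lemma pullback_seq a b th : good_pair a b th -> exists s : nat -> CC R -> CC R,
  [/\ s 0%N = twist th, forall n, invariant a b th (s n)
    & forall n, pullback_step a b th (s n) (s n.+1)].
Proof.
move=> gp; pose T := {h | invariant a b th h}.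
have next (x : T) : {y : T | pullback_step a b th (sval x) (sval y)}.
  apply: cid; case: x => h I /=; have [h' S] := step_ex gp I.
  by exists (exist _ h' (invariant_step gp I S)).
pose s := fix s n : T :=
  if n is m.+1 then sval (next (s m)) else exist _ (twist th) (invariant0 gp).
exists (fun n => sval (s n)); split=> // n; first exact: (svalP (s n)).
exact: (svalP (next (s n))).
Qed.

Lemma pullback_limit a b th s : good_pair a b th ->
  (forall n, invariant a b th (s n)) ->
  (forall n, pullback_step a b th (s n) (s n.+1)) ->
  exists h, (forall e, 0 < e -> exists N, forall n z, (N <= n)%N -> nm (s n z - h z) < e).
Proof.
move=> gp I S; pose c : R := 2 / 100; pose q : R := 25 / 26.
have q01 : 0 <= q < 1 by rewrite /q; apply/andP; split; lra.
have E n : forall z, nm (s n.+1 z - s n z) <= c * q ^+ n.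
  elim: n => [|n IH] z.
    rewrite expr0 mulr1; have := nm_tri z (s 1%N z) (s 0%N z).
    have := inv_near (I 1%N) z; have := inv_near (I 0%N) z.
    by rewrite (nmC z) /c; lra.
  rewrite exprS mulrCA; exact: (step_contract gp (I n.+1) (S n.+1) (I n) (S n) IH).
have /(_ _)/cid lim z := geo_lim q01 (fun n => E n z).
exists (fun z => sval (lim z)) => e e0.
have [N hN] := geo_lt (2 * c / (1 - q)) q01 e0.
exists N => n z /hN; apply: le_lt_trans.
case: (lim z) => l [hl _] /=; apply: le_trans (hl n) _.
have sw (x y : R) : 2 * (c * x * y) = 2 * c * y * x by ring.
by rewrite sw lexx.
Qed.

Record conjugacy a b h : Prop := ConjugacyOf {
  cj_cont : forall z, cont_at h z;
  cj_near : forall z, nm (h z - z) <= 1 / 100;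
  cj_ge : forall z, 3 / 5 <= nm z -> 3 / 5 <= nm (h z);
  cj_eq : forall z, h (cub a z) = cub b (h z) }.

(** The step relates [h_n] and [h_{n+1}] differently on the two sides of the circle, but both
    relations become [h (cub a z) = cub b (h z)] in the limit. The free region leaves no gap: for
    [z] in D the relation is read at the point [cub a z], which is in a petal. *)
Lemma limit_conjugacy a b th s h : good_pair a b th ->
  (forall n, invariant a b th (s n)) ->
  (forall n, pullback_step a b th (s n) (s n.+1)) ->
  (forall e, 0 < e -> exists N, forall n z, (N <= n)%N -> nm (s n z - h z) < e) ->
  conjugacy a b h.
Proof.
move=> gp I S L.
have cl z : clim (fun n => s n z) (h z).
  by move=> e /L[N hN]; exists N => n hn; exact: hN.
split.
- apply: (@uniform_limit_cont s) => [n z|e /L[N hN]]; first exact: (inv_cont (I n)).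
  by exists N => z; exact: hN.
- by move=> z; apply: (clim_le (cl z)) => n; exact: (inv_near (I n)).
- move=> z hz; rewrite -[h z]subr0; apply: (clim_ge (cl z)) => n.
  by rewrite subr0; exact: (inv_ge (I n)).
- move=> z; have c1 := clim_shift (clim_cont (cl z) (cub_cont b (h z))).
  have [z1|z1] := leP (3 / 5) (nm z).
    apply: (clim_uniq (cl _)); apply: clim_ext c1 => n /=.
    by have [e _] := ps_outer (S n) z1; rewrite {1}/cub e subrK.
  apply: (clim_uniq (clim_shift (cl _))).
  apply: clim_ext (clim_cont (cl z) (cub_cont b (h z))) => n /=.
  rewrite -[cub a z]mul1r (step_petal gp (S n)) ?mul1r ?expr1n//; exact: ltW.
Qed.

Lemma limit_cancel (s t : nat -> CC R -> CC R) h k :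
  (forall n, cancel (s n) (t n)) -> (forall z, cont_at k z) ->
  (forall e, 0 < e -> exists N, forall n z, (N <= n)%N -> nm (s n z - h z) < e) ->
  (forall e, 0 < e -> exists N, forall n z, (N <= n)%N -> nm (t n z - k z) < e) ->
  cancel h k.
Proof.
move=> st ck L M z.
have cl : clim (fun n => s n z) (h z).
  by move=> e /L[N hN]; exists N => n hn; exact: hN.
apply: (clim_uniq (clim_cont cl (ck _))) => e /M[N hN]; exists N => n hn /=.
by rewrite nmC -{1}(st n z); exact: hN.
Qed.

Theorem conjugacy_ex a b th : good_pair a b th -> exists h k,
  [/\ conjugacy a b h, conjugacy b a k, cancel h k & cancel k h].
Proof.
move=> gp; have gp' := good_pair_sym gp.
have [s [s0 I S]] := pullback_seq gp; have [t [t0 J T]] := pullback_seq gp'.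
have [h L] := pullback_limit gp I S; have [k M] := pullback_limit gp' J T.
have st n : cancel (s n) (t n).
  elim: n => [|n IH]; first by rewrite s0 t0; exact: twistK.
  exact: (step_inverse gp (I n) (S n) (J n) (T n) IH).
have ts n : cancel (t n) (s n).
  elim: n => [|n IH]; first by rewrite s0 t0 => z; rewrite -{1}(opprK th) twistK.
  apply: (step_inverse gp' (J n) (T n) _ _ IH); rewrite opprK; [exact: I|exact: S].
have ch := limit_conjugacy gp I S L; have ck := limit_conjugacy gp' J T M.
exists h, k; split => //.
  exact: limit_cancel st (cj_cont ck) L M.
exact: limit_cancel ts (cj_cont ch) M L.
Qed.

End Conjugacy.

(** * Poincaré functions *)

Section Extension.
Context {R : realType}.
Implicit Types (z w la : CC R) (f g : CC R -> CC R).

Lemma scale_small la z (d : R) : 1 < nm la -> 0 < d ->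
  exists N, forall n, (N <= n)%N -> nm (z / la ^+ n) < d.
Proof.
move=> l1 d0.
have k01 : 0 <= (nm la)^-1 < 1.
  by rewrite invr_ge0 nm_ge0/= invf_lt1// (lt_trans ltr01).
have [N hN] := geo_lt (nm z) k01 d0.
by exists N => n /hN; rewrite nmM nmV nmX exprVn.
Qed.

(* The functional equation propagates a germ at 0 to the whole plane because
   division by [la] contracts. *)
Lemma scaling_extension P (la : CC R) f0 (d : R) : 1 < nm la -> 0 < d ->
  (forall z, nm z <= d -> f0 z = P (f0 (z / la))) ->
  exists f, (forall z, nm z <= d -> f z = f0 z) /\ forall z, f (la * z) = P (f z).
Proof.
move=> l1 d0 hf.
have la0 : la != 0 by apply: contraTneq l1 => ->; rewrite nm0 -leNgt ler01.
have nla x : nm (x / la) <= nm x.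
  by rewrite nmM nmV ler_piMr ?nm_ge0// invf_le1 ?ltW// (lt_trans ltr01).
(* Once [z / la ^+ n] is in the disc the candidate value no longer depends on [n], so the extension
   is well defined. *)
have st z n m : nm (z / la ^+ n) <= d ->
    iter (n + m) P (f0 (z / la ^+ (n + m))) = iter n P (f0 (z / la ^+ n)).
  elim: m n => [|m IH] n hn; first by rewrite addn0.
  have hn1 : nm (z / la ^+ n.+1) <= d.
    by apply: le_trans hn; rewrite exprSr invfM mulrA; exact: nla.
  rewrite -addSnnS IH// iterSr; congr (iter n P _).
  by rewrite (hf (z / la ^+ n))// exprSr invfM mulrA.
have /(_ _)/cid hF z : exists y, forall n, nm (z / la ^+ n) <= d ->
    y = iter n P (f0 (z / la ^+ n)).
  have [N /(_ N (leqnn _)) hN] := scale_small z l1 d0.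
  exists (iter N P (f0 (z / la ^+ N))) => n hn.
  by rewrite -(st z n N hn) addnC (st z N n (ltW hN)).
exists (fun z => sval (hF z)); split=> z.
  by move=> hz; case: (hF z) => y /= /(_ 0%N); rewrite expr0 divr1; apply.
have [N /(_ N (leqnn _)) hN] := scale_small z l1 d0.
case: (hF z) => y /= /(_ N (ltW hN)) ->.
case: (hF (la * z)) => y' /= /(_ N.+1).
have -> : la * z / la ^+ N.+1 = z / la ^+ N.
  by rewrite exprS invfM mulrACA divff// mul1r.
by move=> /(_ (ltW hN)) ->.
Qed.

Lemma climB (u v : nat -> CC R) (l m : CC R) : clim u l -> clim v m -> clim (fun n => u n - v n) (l - m).
Proof.
move=> hu hv e e0; have e2 : 0 < e / 2 by rewrite divr_gt0.
have [N hN] := hu _ e2; have [M hM] := hv _ e2.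
exists (maxn N M) => n; rewrite geq_max => /andP[/hN h1 /hM h2].
rewrite (_ : _ - _ = (u n - l) - (v n - m)); last by ring.
apply: le_lt_trans (nmB _ _) _; lra.
Qed.

(* Carathéodory's form of differentiability, convenient for composition. *)
Definition cdiff f z := exists D : CC R -> CC R,
  (forall w, f w - f z = (w - z) * D w) /\ cont_at D z.

Lemma cdiff_cont f z : cdiff f z -> cont_at f z.
Proof.
move=> [D [hD cD]].
have -> : f = (fun w => f z + (w - z) * D w).
  by apply/funext => w; rewrite -hD addrC subrK.
apply: cont_atD; first exact: cont_at_cst.
by apply: cont_atM => //; apply: cont_atB; [exact: cont_at_id|exact: cont_at_cst].
Qed.

Lemma cdiff_comp f g z : cdiff g z -> cdiff f (g z) -> cdiff (f \o g) z.
Proof.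
move=> cg [Df [hf cf]]; have cgz := cdiff_cont cg; have [Dg [hg cDg]] := cg.
exists (fun w => Dg w * Df (g w)); split; first by move=> w /=; rewrite hf hg mulrA.
by apply: cont_atM => //; exact: (cont_at_comp cgz cf).
Qed.

Lemma cdiff_cub a z : cdiff (cub a) z.
Proof.
exists (fun w => w ^+ 2 + w * z + z ^+ 2); split; first by move=> w; rewrite /cub; ring.
apply: cont_atD; last exact: cont_at_cst.
apply: cont_atD; [apply: cont_atX; exact: cont_at_id|apply: cont_atM; [exact: cont_at_id|exact: cont_at_cst]].
Qed.

Lemma cdiff_scale la z : cdiff (fun w => w / la) z.
Proof.
by exists (fun _ => la^-1); split; [move=> w; rewrite mulrBl|exact: cont_at_cst].
Qed.

Lemma cdiff_near f g z (d : R) : 0 < d -> (forall w, nm (w - z) < d -> f w = g w) ->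
  cdiff f z -> cdiff g z.
Proof.
move=> d0 fg [D [hD cD]].
exists (fun w => if nm (w - z) < d then D w else (g w - g z) / (w - z)); split.
  move=> w; case: ifP => hw; first by rewrite -!fg ?hD// subrr nm0.
  rewrite mulrC divfK//; apply/eqP => h; move: hw; rewrite h nm0 d0; discriminate.
by apply: (cont_at_near d0 _ cD) => w ->.
Qed.

Lemma cdiff_quadratic f z (l : CC R) (M d : R) : 0 < d ->
  (forall w, nm (w - z) < d -> nm (f w - f z - (w - z) * l) <= M * nm (w - z) ^+ 2) ->
  cdiff f z.
Proof.
move=> d0 h; exists (fun w => if w == z then l else (f w - f z) / (w - z)); split.
  move=> w; case: eqP => [->|/eqP wz]; first by rewrite !subrr mul0r.
  by rewrite mulrC divfK// subr_eq0.
move=> e e0; pose M' := `|M| + 1; have M0 : 0 < M' by rewrite ltr_wpDl.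
exists (Num.min d (e / M')); first by rewrite lt_min d0 divr_gt0.
move=> w; rewrite lt_min ltr_pdivlMr// eqxx => /andP[/h h1 h2].
case: eqP => [_|/eqP wz]; first by rewrite subrr nm0.
have wz0 : w - z != 0 by rewrite subr_eq0.
have n0 := nm_gt0 wz0.
apply: le_lt_trans h2; rewrite -(ler_pM2r n0) -nmM mulrBl divfK// [l * _]mulrC.
apply: le_trans h1 _; rewrite mulrAC -expr2 mulrC.
have MM : 0 <= M' - M by rewrite /M'; have := ler_norm M; lra.
by have := mulr_ge0 MM (exprn_ge0 2 (ltW n0)); lra.
Qed.

(* The difference quotients of the [s n] at [z] are Lipschitz with a common
   constant; this passes to the limit, so [f] is differentiable although no
   convergence of the derivatives is known. *)
Lemma quadratic_limit (s : nat -> CC R -> CC R) f z (M d : R) : 0 < d ->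
  (forall n, exists l : CC R, forall w, nm (w - z) < d ->
     nm (s n w - s n z - (w - z) * l) <= M * nm (w - z) ^+ 2) ->
  (forall w, nm (w - z) < d -> clim (s ^~ w) (f w)) -> cdiff f z.
Proof.
move=> d0 hs cl.
have zd : nm (z - z) < d by rewrite subrr nm0.
pose sl w := (f w - f z) / (w - z).
have M0 : 0 <= M.
  have [l hl] := hs 0%N; pose w := z + (d / 2)%:C.
  have d2 : 0 < d / 2 by rewrite divr_gt0.
  have wz : nm (w - z) = d / 2 by rewrite /w addrC addKr nm_real gtr0_norm.
  have := hl w; rewrite wz => /(_ _)/(le_trans (nm_ge0 _)).
  by rewrite pmulr_lge0 ?exprn_gt0//; apply; lra.
have key w w' : nm (w - z) < d -> nm (w' - z) < d -> w != z -> w' != z ->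
    nm (sl w - sl w') <= M * (nm (w - z) + nm (w' - z)).
  move=> hw hw' wz wz'.
  have ca c : c != z -> nm (c - z) < d -> clim (fun n => (s n c - s n z) / (c - z)) (sl c).
    move=> cz hc; have := climB (cl c hc) (cl z zd).
    move=> /(@clim_cont R _ _ (fun x => x / (c - z))); apply.
    by apply: cont_atM; [exact: cont_at_id|exact: cont_at_cst].
  rewrite -[sl w - sl w']subr0; apply: (clim_le (climB (ca w wz hw) (ca w' wz' hw'))) => n.
  have [l hl] := hs n.
  have B c : c != z -> nm (c - z) < d -> nm ((s n c - s n z) / (c - z) - l) <= M * nm (c - z).
    move=> cz hc; have c0 : c - z != 0 by rewrite subr_eq0.
    rewrite -(ler_pM2r (nm_gt0 c0)) -nmM mulrBl divfK// [l * _]mulrC -mulrA -expr2.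
    exact: hl.
  have := B w wz hw; have := B w' wz' hw'; rewrite subr0 mulrDr.
  have := nm_tri l ((s n w - s n z) / (w - z)) ((s n w' - s n z) / (w' - z)).
  rewrite (nmC l); lra.
(* The derivative is obtained as the limit of the difference quotients along these points, which
   [key] makes Cauchy at rate 1/2. *)
pose t n : CC R := z + (d / 2 ^+ n.+1)%:C.
have p2 n : 0 < (2 : R) ^+ n by rewrite exprn_gt0.
have tz n : nm (t n - z) = d / 2 ^+ n.+1.
  by rewrite /t addrC addKr nm_real gtr0_norm// divr_gt0.
have td n : nm (t n - z) < d.
  by rewrite tz ltr_pdivrMr// ltr_pMr// exprn_egt1// ltr1n.
have tnz n : t n != z.
  by apply/eqP => h; have := tz n; rewrite h subrr nm0 => /eqP; rewrite lt_eqF// divr_gt0.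
have h2 : 0 <= (1 / 2 : R) < 1 by apply/andP; split; lra.
have [|l [_ hl]] := @geo_lim R (fun n => sl (t n)) (M * d) (1 / 2) h2.
  move=> n; apply: le_trans (key _ _ (td _) (td _) (tnz _) (tnz _)) _.
  rewrite !tz -mulrA ler_wpM2l// mul1r exprVn !exprS.
  have : 0 <= d / 2 ^+ n by rewrite divr_ge0 ?ltW.
  by rewrite !invfM; lra.
apply: (@cdiff_quadratic f z l M d d0) => w hw.
have [->|wz] := eqVneq w z; first by rewrite !subrr mul0r subr0 nm0 expr0n mulr0.
have wz0 : w - z != 0 by rewrite subr_eq0.
have n0 := nm_gt0 wz0.
suff H : nm (sl w - l) <= M * nm (w - z).
  have -> : f w - f z - (w - z) * l = (sl w - l) * (w - z) by rewrite [in RHS]mulrBl /sl divfK// [l * _]mulrC.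
  by rewrite nmM expr2 mulrA ler_wpM2r ?nm_ge0.
apply/ler_addgt0Pr => e e0.
have e2 : 0 < e / 2 by rewrite divr_gt0.
have [N1 hN1] := hl _ e2; have [N2 hN2] := geo_lt (M * d) h2 e2.
pose n := maxn N1 N2.
have h3 := hN1 n (leq_maxl _ _); have h4 := hN2 n (leq_maxr _ _).
have := key w (t n) hw (td n) wz (tnz n); rewrite mulrDr tz.
have -> : M * (d / 2 ^+ n.+1) = M * d * (1 / 2) ^+ n * (1 / 2).
  by rewrite !mul1r exprVn exprS invfM; ring.
have := nm_tri (sl (t n)) (sl w) l.
have : 0 <= M * d * (1 / 2) ^+ n by rewrite !mulr_ge0// ?exprn_ge0 ?(ltW d0)//; lra.
lra.
Qed.
End Extension.

(** * Koenigs linearization at the repelling fixed point *)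

Section Poincare.
Context {R : realType}.
Implicit Types (z w x y : CC R) (f g : CC R -> CC R).
(** Each constant is the one for which an induction closes: [C * (L - 1) = 2 * K],
    [M * (L - 1) ^+ 2 = 4 * (3 * nm be + 6)], [4 * K * d <= L - 1], and [q < 1] because
    [(L - 1) ^+ 2] is positive. *)
Variables (a be la : CC R) (L K d M C q : R).
Hypothesis fix_be : cub a be = be.
Hypothesis la_def : la = 3 * be ^+ 2.
Hypothesis L_def : L = nm la.
Hypothesis L1 : 1 < L.
Hypothesis K_def : K = 12 * nm be + 12.
Hypothesis d_def : d = (L - 1) / (4 * K + L).
Hypothesis M_def : M = 4 * (3 * nm be + 6) / (L - 1) ^+ 2.
Hypothesis C_def : C = 2 * K / (L - 1).
Hypothesis q_def : q = (2 * L - 1) / L ^+ 2.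

(* The polynomial [cub a] in the coordinate centred at its fixed point [be]. *)
Definition germ_map w : CC R := la * w + 3 * be * w ^+ 2 + w ^+ 3.
Definition germ_slope x y : CC R := la + 3 * be * (x + y) + (x ^+ 2 + x * y + y ^+ 2).

(** The approximants of Koenigs: the n-th iterate of [germ_map] at [z / la ^+ n]. With the outermost
    factor peeled off, the functional equation is immediate in the limit. *)
Fixpoint germ_iter n z : CC R := if n is m.+1 then germ_map (germ_iter m (z / la)) else z.

Lemma germ_mapE w : cub a (be + w) = be + germ_map w.
Proof. by rewrite -{2}fix_be /cub /germ_map la_def; ring. Qed.

Lemma germ_map_sub x y : germ_map x - germ_map y = (x - y) * germ_slope x y.
Proof. by rewrite /germ_map /germ_slope; ring. Qed.

Lemma germ_map_taylor x y : germ_map x - germ_map y =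
  (x - y) * germ_slope y y + (x - y) ^+ 2 * (3 * be + x + 2 * y).
Proof. by rewrite /germ_map /germ_slope; ring. Qed.

Ltac lraL := have := L1; lra.
Ltac nraL := have := L1; nra.
Let K12 : 12 <= K. Proof. by rewrite K_def; have := nm_ge0 be; lraL. Qed.
Let L0 : 0 < L. Proof. exact: lt_trans L1. Qed.
Let d0 : 0 < d.
Proof. by rewrite d_def divr_gt0//; have := K12; lraL. Qed.
Let d1 : d <= 1.
Proof. by rewrite d_def ler_pdivrMr; have := K12; lraL. Qed.
Let Kd : 4 * K * d <= L - 1.
Proof.
have D0 : 0 < 4 * K + L by have := K12; lraL.
rewrite d_def mulrA ler_pdivrMr// mulrC ler_wpM2l//; lraL.
Qed.
Let la0 : la != 0.
Proof. by apply: contraTneq L1 => h; rewrite L_def h nm0 -leNgt ler01. Qed.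

Lemma germ_slope_near x y (m : R) : nm x <= 2 * m -> nm y <= 2 * m -> m <= 1 ->
  nm (germ_slope x y - la) <= K * m.
Proof.
move=> hx hy m1.
rewrite (_ : _ - la = 3 * be * (x + y) + (x ^+ 2 + x * y + y ^+ 2)); last by rewrite /germ_slope; ring.
apply: le_trans (nmD _ _) _.
have h1 : nm (3 * be * (x + y)) <= 12 * nm be * m.
  rewrite !nmM (nm_nat 3); have := nmD x y; have := nm_ge0 be; nraL.
have h2 : nm (x ^+ 2 + x * y + y ^+ 2) <= 12 * m.
  apply: le_trans (quad_form_le x y) _.
  by have := nm_ge0 x; have := nm_ge0 y; nraL.
by rewrite K_def; lraL.
Qed.

Lemma germ_iter0 n : germ_iter n 0 = 0.
Proof.
by elim: n => //= n IH; rewrite mul0r IH /germ_map !expr0n /= !mulr0 !addr0.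
Qed.

Lemma nm_scale z : nm (z / la) = nm z / L.
Proof. by rewrite nmM nmV -L_def. Qed.

Lemma scale_le z (m : R) : nm z <= m -> nm (z / la) <= m / L.
Proof. by rewrite nm_scale ler_pM2r// invr_gt0. Qed.

Lemma divL_le (m : R) : 0 <= m -> m / L <= m.
Proof. by move=> m0; rewrite ler_piMr// invf_le1// ltW. Qed.

Lemma scale_ball z (m : R) : nm z <= m -> nm (z / la) <= m.
Proof.
move=> h; apply: le_trans (scale_le h) _; apply: divL_le.
exact: le_trans (nm_ge0 _) h.
Qed.

Let Cd : C * d <= 1 / 2.
Proof.
have h : 0 < L - 1 by lraL.
by rewrite C_def mulrAC ler_pdivrMr//; have := Kd; lraL.
Qed.
Let C0 : 0 < C.
Proof. by rewrite C_def divr_gt0//; have := K12; lraL. Qed.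

Ltac lraC := have := L1; have := d0; have := d1; have := C0; have := Cd; lra.
(** The radius [m] stays free in the induction: the hypothesis is used at [z / la] with [m / L], and
    the gain in radius pays for the nonlinear error of one more [germ_map]. *)
Lemma germ_iter_lip n z w (m : R) : nm z <= m -> nm w <= m -> m <= d ->
  nm (germ_iter n z - germ_iter n w - (z - w)) <= C * m * nm (z - w).
Proof.
elim: n z w m => [|n IH] z w m hz hw hm /=.
  have m0 : 0 <= m by exact: le_trans (nm_ge0 _) hz.
  by rewrite subrr nm0 !mulr_ge0 ?nm_ge0 ?(ltW C0).
have m0 : 0 <= m by exact: le_trans (nm_ge0 _) hz.
have mL := divL_le m0; have mL0 : 0 <= m / L by rewrite divr_ge0// ltW.
have hz' := scale_le hz; have hw' := scale_le hw.
set z' := z / la in hz' *; set w' := w / la in hw' *.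
have lip u v : nm u <= m / L -> nm v <= m / L ->
    nm (germ_iter n u - germ_iter n v) <= 2 * nm (u - v).
  move=> hu hv; have := IH u v (m / L) hu hv (le_trans mL hm).
  have := nm_sub (germ_iter n u - germ_iter n v) (u - v).
  have : C * (m / L) * nm (u - v) <= 1 * nm (u - v).
    rewrite ler_wpM2r ?nm_ge0//; have : C * (m / L) <= C * d.
      by rewrite ler_wpM2l ?(ltW C0)//; lraC.
    lraC.
  lraC.
have small u : nm u <= m / L -> nm (germ_iter n u) <= 2 * (m / L).
  move=> hu; have := lip u 0 hu; rewrite nm0 germ_iter0 !subr0 => /(_ mL0); lraC.
set x := germ_iter n z'; set y := germ_iter n w'.
have ezw : z - w = la * (z' - w') by rewrite /z' /w' -mulrBl mulrC divfK.
have -> : germ_map x - germ_map y - (z - w) =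
    (x - y) * (germ_slope x y - la) + la * (x - y - (z' - w')).
  by rewrite germ_map_sub ezw; ring.
apply: le_trans (nmD _ _) _; rewrite !nmM -L_def.
have mL1 : m / L <= 1 by have := d1; lraC.
have h1 := germ_slope_near (small _ hz') (small _ hw') mL1.
have h2 := lip _ _ hz' hw'; have h3 := IH _ _ _ hz' hw' (le_trans mL hm).
rewrite -/x -/y in h1 h2 h3.
have e3 : nm (z - w) = L * nm (z' - w') by rewrite ezw nmM -L_def.
set t := nm (z' - w') in h2 h3 e3 *; rewrite e3.
have t0 : 0 <= t by exact: nm_ge0.
have h4 : nm (x - y) * nm (germ_slope x y - la) <= 2 * t * (K * (m / L)).
  by rewrite ler_pM ?nm_ge0.
have h5 : L * nm (x - y - (z' - w')) <= L * (C * (m / L) * t).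
  by rewrite ler_wpM2l// ltW.
have eC : C * (L - 1) = 2 * K by rewrite C_def divfK// subr_eq0 gt_eqF.
have em : L * (m / L) = m by rewrite mulrC divfK// gt_eqF.
have h6 : 2 * t * (K * (m / L)) = C * (L - 1) * (m / L) * t by rewrite eC; ring.
have h7 : C * (L - 1) * (m / L) * t = C * (m - m / L) * t.
  by rewrite -{2}em; ring.
have h8 : L * (C * (m / L) * t) = C * m * t by rewrite -{2}em; ring.
have h9 : C * m * (L * t) - C * m * t - C * (m - m / L) * t = C * t * (m * (L - 1) - (m - m / L)) by ring.
have h10 : 0 <= C * t * (m * (L - 1) - (m - m / L)).
  apply: mulr_ge0; first by rewrite mulr_ge0// ltW.
  have -> : m * (L - 1) - (m - m / L) = (m / L) * (L - 1) ^+ 2.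
    by rewrite -{1 2}em; ring.
  by rewrite mulr_ge0// sqr_ge0.
lraC.
Qed.

Lemma germ_iter_lip2 n z w : nm z <= d -> nm w <= d ->
  nm (germ_iter n z - germ_iter n w - (z - w)) <= 1 / 2 * nm (z - w).
Proof.
move=> hz hw; apply: le_trans (germ_iter_lip n hz hw (lexx _)) _.
by rewrite ler_wpM2r ?nm_ge0//; exact: Cd.
Qed.

Lemma germ_iter_small n z (m : R) : nm z <= m -> m <= d -> nm (germ_iter n z) <= 2 * m.
Proof.
move=> hz hm; have zd := le_trans hz hm.
have := @germ_iter_lip2 n z 0 zd; rewrite nm0 germ_iter0 !subr0 => /(_ (ltW d0)).
have := nm_sub (germ_iter n z) z; have := nm_ge0 z; lraC.
Qed.

(** What counts is [2 * L - 1 < L ^+ 2]: quadratic errors gain [L ^- 2] from the rescaling, more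
    than this slope loses. *)
Lemma germ_slope_bound n m z w : nm z <= d -> nm w <= d ->
  nm (germ_slope (germ_iter n (z / la)) (germ_iter m (w / la))) <= 2 * L - 1.
Proof.
move=> hz hw; have hz' := scale_ball hz; have hw' := scale_ball hw.
have := germ_slope_near (germ_iter_small n hz' (lexx _)) (germ_iter_small m hw' (lexx _)) d1.
have := nm_sub (germ_slope (germ_iter n (z / la)) (germ_iter m (w / la))) la.
have := Kd; rewrite -L_def; nraL.
Qed.

(** A second-order Taylor bound uniform in [n], with [l] given by the chain rule. One step turns [M]
    into [M * (2 * L - 1) + M * (L - 1) ^+ 2], divided by [L ^+ 2], which is [M] again. *)
Lemma germ_iter_quad n z : nm z <= d -> exists l : CC R, forall w, nm w <= d ->
  nm (germ_iter n w - germ_iter n z - (w - z) * l) <= M * nm (w - z) ^+ 2.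
Proof.
have M0 : 0 <= M.
  by rewrite M_def divr_ge0 ?sqr_ge0//; have := nm_ge0 be; lraC.
elim: n z => [|n IH] z hz.
  exists 1 => w hw /=; rewrite mulr1 subrr nm0 mulr_ge0 ?sqr_ge0//.
have hz' := scale_ball hz; have [l hl] := IH _ hz'.
set y := germ_iter n (z / la).
exists (germ_slope y y * l / la) => w hw /=; have hw' := scale_ball hw.
set x := germ_iter n (w / la); rewrite -/y.
have -> : germ_map x - germ_map y - (w - z) * (germ_slope y y * l / la) =
   (x - y - (w / la - z / la) * l) * germ_slope y y + (x - y) ^+ 2 * (3 * be + x + 2 * y).
  by rewrite germ_map_taylor; ring.
have h1 := hl _ hw'; rewrite -/x -/y in h1.
have ewz : nm (w / la - z / la) = nm (w - z) / L by rewrite -mulrBl nm_scale.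
rewrite ewz in h1; set t := nm (w - z) in h1 ewz *.
have h2 : nm (germ_slope y y) <= 2 * L - 1 by exact: germ_slope_bound.
have h3 : nm (x - y) <= 2 * (t / L).
  have := germ_iter_lip2 n hw' hz'; have := nm_sub (x - y) (w / la - z / la).
  rewrite -/x -/y ewz; have : 0 <= t / L by rewrite divr_ge0 ?nm_ge0// ltW.
  lraC.
have h4 : nm (3 * be + x + 2 * y) <= 3 * nm be + 6.
  have := germ_iter_small n hw' (lexx _); have := germ_iter_small n hz' (lexx _).
  rewrite -/x -/y; have := nmD (3 * be + x) (2 * y); have := nmD (3 * be) x.
  rewrite !nmM (nm_nat 3) (nm_nat 2); have := d1; lraC.
apply: le_trans (nmD _ _) _.
rewrite (nmM (x - y - _)) (nmM ((x - y) ^+ 2)) nmX.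
set B : R := 3 * nm be + 6 in h4 *.
have B0 : 0 <= B by rewrite /B; have := nm_ge0 be; lraC.
have s0 : 0 <= (t / L) ^+ 2 by exact: sqr_ge0.
have h5 : nm (x - y - (w / la - z / la) * l) * nm (germ_slope y y) <= M * (t / L) ^+ 2 * (2 * L - 1).
  by rewrite ler_pM ?nm_ge0.
have h6 : nm (x - y) ^+ 2 * nm (3 * be + x + 2 * y) <= (2 * (t / L)) ^+ 2 * B.
  by rewrite ler_pM ?nm_ge0 ?sqr_ge0// lerXn2r// ?nnegrE ?nm_ge0// mulr_ge0// divr_ge0 ?nm_ge0// ltW.
have eM : M * (L - 1) ^+ 2 = 4 * B.
  by rewrite M_def divfK// expf_eq0 subr_eq0 gt_eqF.
have et : t ^+ 2 = (t / L) ^+ 2 * L ^+ 2 by rewrite expr_div_n divfK// expf_eq0 gt_eqF.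
rewrite et.
have : (2 * (t / L)) ^+ 2 * B = M * (L - 1) ^+ 2 * (t / L) ^+ 2 by rewrite eM; ring.
lraC.
Qed.

Let q01 : 0 <= q < 1.
Proof.
have L2 : 0 < L ^+ 2 by rewrite exprn_gt0.
rewrite q_def divr_ge0 ?(ltW L2)//=; last by lraC.
by rewrite ltr_pdivrMr//; nraL.
Qed.

Lemma germ_iter_cauchy n z : nm z <= d ->
  nm (germ_iter n.+1 z - germ_iter n z) <= K * nm z ^+ 2 * q ^+ n.
Proof.
elim: n z => [|n IH] z hz.
  rewrite expr0 mulr1 /=.
  have ez : la * (z / la) = z by rewrite mulrC divfK.
  rewrite (_ : _ - z = (z / la) ^+ 2 * (3 * be + z / la)); last first.
    by rewrite /germ_map ez; ring.
  rewrite nmM nmX mulrC; apply: ler_pM; rewrite ?nm_ge0 ?sqr_ge0//.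
    have := nmD (3 * be) (z / la); rewrite nmM (nm_nat 3).
    have := scale_ball hz; have := d1; have := nm_ge0 be; rewrite K_def; lraC.
  by rewrite lerXn2r ?nnegrE ?nm_ge0//; apply: scale_ball.
have hz' := scale_ball hz.
rewrite [germ_iter n.+2 z]/= [germ_iter n.+1 z]/= germ_map_sub nmM.
have := @germ_slope_bound n.+1 n z z hz hz.
have := IH _ hz'; rewrite nm_scale => h1 h2.
apply: le_trans (ler_pM _ _ h1 h2) _; rewrite ?nm_ge0//.
rewrite [q ^+ n.+1]exprSr le_eqVlt; apply/orP; left; apply/eqP.
by rewrite expr_div_n {3}q_def; ring.
Qed.

Lemma poincare_ex_aux : exists f (r : R), 0 < r /\
  [/\ f 0 = be,
      forall z w, nm z <= r -> nm w <= r -> nm (f z - f w - (z - w)) <= 1 / 2 * nm (z - w),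
      forall z, f (la * z) = cub a (f z)
    & forall z, cdiff f z].
Proof.
have la1 : 1 < nm la by rewrite -L_def.
have /(_ _)/cid hG z : exists l : CC R, nm z <= d -> clim (fun n => germ_iter n z) l.
  have [hz|hz] := pselect (nm z <= d); last by exists 0.
  have [l [_ hl]] := geo_lim q01 (fun n => germ_iter_cauchy n hz).
  by exists l.
pose G z := sval (hG z).
have cl z : nm z <= d -> clim (fun n => germ_iter n z) (G z).
  by rewrite /G; case: (hG z).
have G0 : G 0 = 0.
  apply: (clim_uniq (cl 0 _)); first by rewrite nm0 ltW.
  by move=> e e0; exists 0%N => n _; rewrite germ_iter0 subrr nm0.
have Gmap z : nm z <= d -> G z = germ_map (G (z / la)).
  move=> hz; apply: (clim_uniq (clim_shift (cl z hz))).
  apply: (clim_cont (cl _ (scale_ball hz))).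
  apply: cont_atD; last by apply: cont_atX; exact: cont_at_id.
  apply: cont_atD; apply: cont_atM; try exact: cont_at_cst; try exact: cont_at_id.
  by apply: cont_atX; exact: cont_at_id.
have Glip z w : nm z <= d -> nm w <= d -> nm (G z - G w - (z - w)) <= 1 / 2 * nm (z - w).
  move=> hz hw; apply: (clim_le (climB (cl z hz) (cl w hw))) => n.
  exact: germ_iter_lip2.
pose f0 z := be + G z.
have f0E z : nm z <= d -> f0 z = cub a (f0 (z / la)).
  by move=> hz; rewrite /f0 germ_mapE -Gmap.
have [f [ff0 fE]] := scaling_extension la1 d0 f0E.
have fdiff0 z : nm z < d -> cdiff f z.
  move=> hz; have dz : 0 < d - nm z by lra.
  have wd w : nm (w - z) < d - nm z -> nm w <= d.
    by move=> hw; have := nm_sub w z; lra.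
  have : cdiff G z.
    apply: (@quadratic_limit _ germ_iter G z M _ dz).
      move=> n; have [l hl] := germ_iter_quad n (ltW hz).
      by exists l => w /wd; exact: hl.
    by move=> w /wd; exact: cl.
  move=> [D [hD cD]]; apply: (@cdiff_near _ (fun w => be + G w) f z _ dz).
    by move=> w /wd hw; rewrite ff0.
  by exists D; split => // w; rewrite -hD; ring.
exists f, d; split => //; split.
- by rewrite ff0 ?nm0 ?(ltW d0)// /f0 G0 addr0.
- move=> z w hz hw; rewrite !ff0//.
  by rewrite (_ : f0 z - f0 w = G z - G w); [exact: Glip|rewrite /f0; ring].
- exact: fE.
(* Differentiability spreads from the disc through [f z = cub a (f (z / la))], one factor [la] at a
   time. *)
- move=> z; have [N /(_ N (leqnn _)) hN] := scale_small z la1 d0.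
  elim: N z hN => [|N IH] z hN; first by apply: fdiff0; move: hN; rewrite expr0 divr1.
  have -> : f = cub a \o (f \o (fun w => w / la)).
    by apply/funext => w /=; rewrite -fE mulrC divfK.
  apply: cdiff_comp; last exact: cdiff_cub.
  apply: cdiff_comp; first exact: cdiff_scale.
  by apply: IH; rewrite -mulrA -invfM -exprS.
Qed.
End Poincare.

Theorem poincare_ex (R : realType) (a be la : CC R) :
  cub a be = be -> la = 3 * be ^+ 2 -> 1 < nm la ->
  exists f (r : R), 0 < r /\
  [/\ f 0 = be,
      forall z w, nm z <= r -> nm w <= r -> nm (f z - f w - (z - w)) <= 1 / 2 * nm (z - w),
      forall z, f (la * z) = cub a (f z)
    & forall z, cdiff f z].
Proof.
by move=> h1 h2 h3; exact: (poincare_ex_aux h1 h2 erefl h3 erefl erefl erefl erefl erefl).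
Qed.

Section PoincareFunctions.
Context {R : realType}.
Implicit Types (z w x y : CC R) (f g : CC R -> CC R).

(* On |z| <= r, [f] is close enough to a translation to be invertible. *)
Record poincare (a be la : CC R) f (r : R) : Prop := Poincare {
  po_fix : cub a be = be;
  po_la : 1 < nm la;
  po_r : 0 < r;
  po_0 : f 0 = be;
  po_lip : forall z w, nm z <= r -> nm w <= r -> nm (f z - f w - (z - w)) <= 1 / 2 * nm (z - w);
  po_eq : forall z, f (la * z) = cub a (f z);
  po_diff : forall z, cdiff f z }.

Section Local.
Variables (a be la : CC R) (f : CC R -> CC R) (r : R).
Hypothesis P : poincare a be la f r.

Lemma po_cont z : cont_at f z. Proof. exact: cdiff_cont (po_diff P z). Qed.

Lemma po_la0 : la != 0.
Proof. by apply: contraTneq (po_la P) => ->; rewrite nm0 -leNgt ler01. Qed.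

Lemma po_lower z w : nm z <= r -> nm w <= r -> nm (z - w) <= 2 * nm (f z - f w).
Proof.
move=> hz hw; have := po_lip P hz hw.
have := nm_sub (z - w) (f z - f w); rewrite (nmC (z - w)); lra.
Qed.

Lemma po_upper z w : nm z <= r -> nm w <= r -> nm (f z - f w) <= 3 / 2 * nm (z - w).
Proof.
move=> hz hw; have := po_lip P hz hw.
have := nm_sub (f z - f w) (z - w); lra.
Qed.

Lemma po_inj z w : nm z <= r -> nm w <= r -> f z = f w -> z = w.
Proof.
move=> hz hw e; have := po_lower hz hw; rewrite e subrr nm0 mulr0 => /nm_le0 h.
by apply/eqP; rewrite -subr_eq0 h.
Qed.

Lemma po_iter n z : f (la ^+ n * z) = iter n (cub a) (f z).
Proof.
elim: n => [|n IH]; first by rewrite expr0 mul1r.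
by rewrite exprS -mulrA (po_eq P) IH.
Qed.

Lemma po_scale n z : f z = iter n (cub a) (f (z / la ^+ n)).
Proof. by rewrite -po_iter mulrC divfK// expf_neq0// po_la0. Qed.

(** Newton-like iteration [z + (y - f z)] from 0: as [f] minus the identity is 1/2-Lipschitz, the
    defect halves at each step. *)
Lemma po_local_inverse y : nm (y - be) < r / 2 ->
  exists2 z, nm z <= 2 * nm (y - be) & f z = y.
Proof.
move=> hy; set s := nm (y - be) in hy *.
pose step z := z + (y - f z); pose x n := iter n step 0.
have s0 : 0 <= s by exact: nm_ge0.
have p0 n : 0 < (1 / 2 : R) ^+ n by apply: exprn_gt0; lra.
have inv n : nm (x n) <= 2 * s * (1 - (1 / 2) ^+ n) /\ nm (y - f (x n)) <= s * (1 / 2) ^+ n.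
  elim: n => [|n [h1 h2]]; first by rewrite expr0 subrr mulr0 mulr1 nm0 /= (po_0 P).
  have xr : nm (x n) <= r by have := p0 n; nra.
  have e : x n.+1 - x n = y - f (x n) by rewrite /x iterS /step addrC addKr.
  have hx : nm (x n.+1) <= 2 * s * (1 - (1 / 2) ^+ n.+1).
    have := nm_sub (x n.+1) (x n); rewrite e exprS; lra.
  split => //.
  have xr' : nm (x n.+1) <= r by have := p0 n.+1; nra.
  have -> : y - f (x n.+1) = - (f (x n.+1) - f (x n) - (x n.+1 - x n)) by rewrite e; ring.
  by rewrite nmN; apply: le_trans (po_lip P xr' xr) _; rewrite e exprS; lra.
have h2 : 0 <= (1 / 2 : R) < 1 by apply/andP; split; lra.
have [|z [_ cl]] := @geo_lim R x s (1 / 2) h2.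
  by move=> n; rewrite /x iterS /step addrC addKr; case: (inv n).
exists z.
  rewrite -[z]subr0; apply: (clim_le cl) => n; rewrite subr0.
  by have [h1 _] := inv n; have := p0 n; nra.
apply: (clim_uniq (clim_cont cl (po_cont z))) => e e0.
have [N hN] := geo_lt s h2 e0; exists N => n /hN.
by apply: le_lt_trans; rewrite nmC; case: (inv n).
Qed.

End Local.

Lemma cdiff_derivable f z : cdiff f z -> derivable f z 1.
Proof.
move=> [D [hD cD]]; apply/cvg_ex; exists (D z); apply/cvg_nm => e /cD[d d0 hd].
apply/near_nm; exists d => // h; rewrite subr0 => hh h0 /=.
rewrite hD addrK [h *: _]mulr1 [_ *: _]mulrA mulVf// mul1r.
by apply: hd; rewrite addrK.
Qed.

Lemma poly_ext (p q : {poly R[i]}) : (forall x, p.[x] = q.[x]) -> p = q.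
Proof.
move=> pq; apply/eqP; rewrite -subr_eq0; apply: contraT => n0.
pose s := [seq (k%:R : R[i]) | k <- iota 0 (size (p - q))].
have := @max_poly_roots _ (p - q) s n0.
rewrite size_map size_iota ltnn => -> //.
  by apply/allP => _ /mapP[k _ ->]; rewrite rootE hornerD hornerN pq subrr.
rewrite map_inj_uniq ?iota_uniq// => m n /eqP.
by rewrite eqr_nat => /eqP.
Qed.

Lemma poincare_entire a be la f r : poincare a be la f r -> entire f.
Proof. by move=> P z; apply: cdiff_derivable; exact: (po_diff P). Qed.

(** A polynomial solution has equal degrees on both sides of the functional equation, n and 3 n,
    hence is constant; but [f] is injective near 0. *)
Lemma poincare_transcendental a be la f r : poincare a be la f r -> transcendental f.
Proof.
move=> P [q hq].
have la0 := po_la0 P.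
have : q \Po ((la : R[i]) *: 'X) = q ^+ 3 + (a : R[i])%:P.
  apply: poly_ext => x.
  rewrite horner_comp hornerZ hornerX !hornerE -!hq.
  by rewrite (po_eq P).
move=> /(congr1 (fun p : {poly R[i]} => size p)).
rewrite size_comp_poly2; last by rewrite size_scale// size_polyX.
have [sq|sq] := leqP (size q) 1.
  have fc z : f z = q`_0 by rewrite hq {1}(size1_polyC sq) hornerC.
  have nr : nm (r%:C) = r by rewrite nm_real gtr0_norm// (po_r P).
  have := @po_inj _ _ _ _ _ P 0 r%:C; rewrite nm0 nr !fc => /(_ (ltW (po_r P)) (lexx _) erefl) h.
  by have := po_r P; rewrite -nr -h nm0 ltxx.
have sq3 := size_exp q 3.
rewrite size_polyDl => [e|]; first by move: sq3; rewrite -e; case: (size q) sq => [|[|n]]//=; lia.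
apply: leq_ltn_trans (size_polyC_leq1 _) _.
by case: (size (q ^+ 3)) sq3 => [|[|n]]//=; case: (size q) sq => [|[|m]]//=; lia.
Qed.

End PoincareFunctions.

(** * The singular set of a Poincaré function *)

Section Covering.
Context {R : realType}.
Implicit Types (x y z w : CC R) (f g : CC R -> CC R).

Lemma open_nm (U : set (CC R)) :
  (forall z, U z -> exists2 d : R, 0 < d & forall w, nm (w - z) < d -> U w) -> open U.
Proof. by move=> h; rewrite openE => z /h hz; apply/near_nm. Qed.

Section Fixed.
Variables (a be la : CC R) (f : CC R -> CC R) (r : R).
Hypothesis P : poincare a be la f r.
Hypothesis na : nm a = 36 / 125.

(* The backward orbits of [f z] and [f w] along the scaling stay close until both
   points are in the disc where [f] is injective. *)
Definition shadow N z w := [/\ nm (z / la ^+ N) < Num.min r (1 / 400),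
  nm (w / la ^+ N) < Num.min r (1 / 400)
  & forall n, (n <= N)%N -> nm (f (z / la ^+ n) - f (w / la ^+ n)) < 1 / 100].

Definition same_sheet z w := exists N, shadow N z w.

Lemma shadow_sym N z w : shadow N z w -> shadow N w z.
Proof. by move=> [h1 h2 h3]; split => // n /h3; rewrite nmC. Qed.

Lemma scale_anti z (c : R) n m : (n <= m)%N -> nm (z / la ^+ n) < c -> nm (z / la ^+ m) < c.
Proof.
move=> /subnKC <-; apply: le_lt_trans; rewrite exprD invfM mulrA nmM nmV nmX.
have l1 : 1 <= nm la ^+ (m - n) by rewrite exprn_ege1// ltW// (po_la P).
by rewrite ler_piMr ?nm_ge0// invf_le1// (lt_le_trans ltr01 l1).
Qed.

(** Beyond [N] closeness is automatic, since [3 / 2 * (1 / 400 + 1 / 400) < 1 / 100]. *)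
Lemma shadow_mono N M z w : (N <= M)%N -> shadow N z w -> shadow M z w.
Proof.
move=> NM [h1 h2 h3]; split; try exact: scale_anti NM _.
move=> n nM; have [nN|/ltnW Nn] := leqP n N; first exact: h3.
have := scale_anti Nn h1; have := scale_anti Nn h2; rewrite !lt_min => /andP[a1 a2] /andP[b1 b2].
apply: le_lt_trans (po_upper P (ltW b1) (ltW a1)) _.
have := nmB (z / la ^+ n) (w / la ^+ n); lra.
Qed.

Lemma f_step z n : f (z / la ^+ n) = cub a (f (z / la ^+ n.+1)).
Proof. by rewrite -(po_eq P) exprS invfM mulrCA mulVKf ?(po_la0 P)// mulrC. Qed.

(** D is forward invariant, so its complement is backward invariant. *)
Lemma outer_back z n : 3 / 5 < nm (f z) -> 3 / 5 < nm (f (z / la ^+ n)).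
Proof.
move=> h; elim: n => [|n]; first by rewrite expr0 divr1.
rewrite f_step => hn; have := nmD (f (z / la ^+ n.+1) ^+ 3) a; rewrite -/(cub a _) na nmX => h2.
rewrite ltNge; apply/negP => /cube_r; lra.
Qed.

Lemma shadow_contract N z w : 3 / 5 < nm (f z) ->
  (forall n, (n <= N)%N -> nm (f (z / la ^+ n) - f (w / la ^+ n)) <= 1 / 50) ->
  forall n, (n <= N)%N -> nm (f (z / la ^+ n) - f (w / la ^+ n)) <= nm (f z - f w).
Proof.
move=> hz h; elim=> [|n IH] hn; first by rewrite !expr0 !divr1.
apply: le_trans (IH (ltnW hn)); rewrite !(f_step _ n).
have := cube_expand (ltW (outer_back n.+1 hz)) (h _ hn).
rewrite (_ : cub a _ - cub a _ = f (z / la ^+ n.+1) ^+ 3 - f (w / la ^+ n.+1) ^+ 3); last by rewrite /cub; ring.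
have := nm_ge0 (f (z / la ^+ n.+1) - f (w / la ^+ n.+1)); lra.
Qed.

Lemma shadow2 N x z w n : shadow N x z -> shadow N x w -> (n <= N)%N ->
  nm (f (z / la ^+ n) - f (w / la ^+ n)) <= 1 / 50.
Proof.
move=> [_ _ h] [_ _ k] hn; have := h _ hn; have := k _ hn.
have := nm_tri (f (x / la ^+ n)) (f (z / la ^+ n)) (f (w / la ^+ n)).
rewrite (nmC (f (z / _)) (f (x / _))); lra.
Qed.

(** Serves twice: with equal values it gives injectivity on a sheet, and in general the continuity
    of the inverse. *)
Lemma shadow_lip N x z w : 3 / 5 < nm (f z) -> shadow N x z -> shadow N x w ->
  nm (z - w) <= nm la ^+ N * (2 * nm (f z - f w)).
Proof.
move=> hz sz sw.
have h := shadow_contract hz (fun n hn => shadow2 sz sw hn) (leqnn N).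
have [_ z1 _] := sz; have [_ w1 _] := sw.
rewrite !lt_min in z1 w1; have /andP[z2 _] := z1; have /andP[w2 _] := w1.
have := po_lower P (ltW z2) (ltW w2); rewrite -mulrBl nmM nmV nmX.
have L0 : 0 < nm la ^+ N by rewrite exprn_gt0// (lt_trans ltr01)// (po_la P).
rewrite ler_pdivrMr// => h2; apply: le_trans h2 _.
by rewrite mulrC ler_wpM2l ?(ltW L0)//; lra.
Qed.

Lemma same_sheet_uniq x z w : 3 / 5 < nm (f z) -> same_sheet x z -> same_sheet x w ->
  f z = f w -> z = w.
Proof.
move=> hz [N sN] [M sM] e.
have s1 := shadow_mono (leq_maxl N M) sN; have s2 := shadow_mono (leq_maxr N M) sM.
have := shadow_lip hz s1 s2; rewrite e subrr nm0 !mulr0 => /nm_le0 h.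
by apply/eqP; rewrite -subr_eq0 h.
Qed.

(** The point [y] is carried back along the orbit of [f z], each time by the cube root nearest to
    that orbit. *)
Lemma outer_pullback z y n : 3 / 5 < nm (f z) -> 3 / 5 < nm y -> nm (y - f z) < 1 / 100 ->
  exists u, [/\ 3 / 5 <= nm u, nm (u - f (z / la ^+ n)) <= (25 / 26) ^+ n * nm (y - f z),
    iter n (cub a) u = y
    & forall k, (k <= n)%N -> nm (iter k (cub a) u - f (z / la ^+ (n - k))) <= nm (y - f z)].
Proof.
move=> hz hy hyz; elim: n => [|n [u [u1 u2 u3 u4]]].
  exists y; split => //; first exact: ltW.
    by rewrite !expr0 divr1 mul1r.
  by move=> k; rewrite leqn0 => /eqP -> /=; rewrite expr0 divr1.
set c := nm (y - f z) in hyz u2 u4 *.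
have c0 : 0 <= c by exact: nm_ge0.
have uc : nm (u - f (z / la ^+ n)) <= c.
  by have := u4 0%N (leq0n _); rewrite subn0.
have z1 := ltW (outer_back n.+1 hz).
have ec : f (z / la ^+ n.+1) ^+ 3 - (u - a) = f (z / la ^+ n) - u.
  by rewrite (f_step z n) /cub; ring.
have [||v [v1 v2 v3]] := @cube_root_lift _ (f (z / la ^+ n.+1)) (u - a) z1.
- by have := nm_sub u a; rewrite na; lra.
- by rewrite ec nmC; lra.
have cv : cub a v = u by rewrite /cub v1 subrK.
rewrite ec nmC in v3.
have v4 : nm (v - f (z / la ^+ n.+1)) <= 25 / 26 * nm (u - f (z / la ^+ n)).
  by rewrite (nmC v) (nmC u); lra.
exists v; split => //.
- rewrite [(25 / 26) ^+ n.+1]exprS -mulrA; apply: le_trans v4 _.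
  by rewrite ler_wpM2l//; lra.
- by rewrite iterSr cv.
move=> [_|k hk]; first by rewrite subn0 /=; lra.
by rewrite iterSr cv subSS; exact: u4.
Qed.

(** [N] is fixed before [y]: so far back that the pulled-back point lies within [m / 2] of [be],
    where the local inverse of [f] applies. The same [N] then serves for the whole disc around
    [f z]. *)
Lemma sheet_section z : 3 / 5 < nm (f z) -> exists N, forall y, 3 / 5 < nm y ->
  nm (y - f z) < 1 / 100 -> exists2 w, f w = y & shadow N z w.
Proof.
move=> hz.
pose m := Num.min r (1 / 400).
have m0 : 0 < m by rewrite lt_min (po_r P); lra.
have m8 : 0 < m / 8 by rewrite divr_gt0.
have [N1 hN1] := scale_small z (po_la P) m8.
have q01 : 0 <= (25 / 26 : R) < 1 by apply/andP; split; lra.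
have [N2 hN2] := geo_lt 1 q01 m8.
pose N := maxn N1 N2; have h1 := hN1 N (leq_maxl _ _); have h2 := hN2 N (leq_maxr _ _).
exists N => y hy hyz.
have mr : m <= r by rewrite /m ge_min lexx.
have [u [u1 u2 u3 u4]] := outer_pullback N hz hy hyz.
have ub : nm (u - be) < m / 2.
  have rz : nm (z / la ^+ N) <= r by lra.
  have r0 : nm (0 : CC R) <= r by rewrite nm0 ltW// (po_r P).
  have := po_upper P rz r0; rewrite subr0 (po_0 P).
  have := nm_tri (f (z / la ^+ N)) u be.
  have p0 : 0 <= (25 / 26 : R) ^+ N by apply: exprn_ge0; lra.
  have := nm_ge0 (y - f z); nra.
have [|v v1 v2] := po_local_inverse P (y := u); first by lra.
have vm : nm v < m by lra.
have ev n : f (la ^+ N * v / la ^+ (N - n)) = iter n (cub a) u \/ (N < n)%N.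
  have [nN|] := leqP n N; last by right.
  left; rewrite -v2 -(po_iter P); congr (f _).
  have -> : la ^+ N * v = la ^+ (N - n) * (la ^+ n * v) by rewrite mulrA -exprD subnK.
  by rewrite mulrC mulKf// expf_neq0// (po_la0 P).
exists (la ^+ N * v).
  by rewrite (po_iter P) v2.
split => //; first by rewrite -/m; lra.
  by rewrite mulrC mulKf// expf_neq0// (po_la0 P).
move=> n hn; rewrite nmC; have := u4 (N - n)%N (leq_subr _ _); rewrite subKn//.
have [<-|] := ev (N - n)%N; first by rewrite subKn//; lra.
by rewrite ltnNge leq_subr.
Qed.

(* Inverse branches of p contract outside the disc of radius 3/5, which is why a
   small disc lifts along every backward orbit. *)
Lemma outer_covering : covering_over f [set w | 3 / 5 < nm w].
Proof.
move=> w /= hw; pose s := Num.min (1 / 100) (nm w - 3 / 5).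
have s0 : 0 < s by rewrite lt_min subr_gt0 hw andbT; lra.
pose V : set (CC R) := [set y | nm (y - w) < s].
have s1 : s <= 1 / 100 by rewrite /s ge_min lexx.
have s2 : s <= nm w - 3 / 5 by rewrite /s ge_min lexx orbT.
have VW y : V y -> 3 / 5 < nm y.
  by rewrite /V /= => h; have := nm_sub w y; rewrite nmC; lra.
have oV : open V.
  apply: open_nm => z hz; exists (s - nm (z - w)); first by rewrite subr_gt0.
  by move=> x hx; rewrite /V /=; have := nm_tri z x w; lra.
exists V; split => //; first by rewrite /V /= subrr nm0.
(* One sheet for each point [z0] of the fibre over [w]. If two sheets share a point,
   [same_sheet_uniq] seen from that point identifies their centres. *)
pose U z0 : set (CC R) := [set z | V (f z) /\ same_sheet z0 z].
exists [set A | exists2 z0, f z0 = w & A = U z0]; split.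
- move=> _ [z0 e0 ->]; apply: open_nm => z [Vz [N [h1 h2 h3]]].
  have nb (Q : CC R -> Prop) : (\forall x \near z, Q x) -> exists2 d : R, 0 < d & forall w, nm (w - z) < d -> Q w.
    by move=> /near_nm.
  apply: nb; have cs n : {for z, continuous (fun x => x / la ^+ n)}.
    by apply/cont_atP; apply: cont_atM; [exact: cont_at_id|exact: cont_at_cst].
  have cfs n : cont_at (fun x => f (x / la ^+ n)) z.
    by apply: (@cont_at_comp _ f (fun x => x / la ^+ n)); [apply/cont_atP|exact: (po_cont P)].
  have n1 : \forall x \near z, V (f x).
    have := cfs 0%N (s - nm (f z - w)); rewrite subr_gt0 => /(_ Vz)[d d0 hd].
    apply/near_nm; exists d => // x /hd; rewrite expr0 !divr1 /V /=.
    by have := nm_tri (f z) (f x) w; lra.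
  have n2 : \forall x \near z, nm (x / la ^+ N) < Num.min r (1 / 400).
    have /cont_atP := cs N; set c := Num.min _ _ in h2 *.
    move=> /(_ (c - nm (z / la ^+ N))); rewrite subr_gt0 => /(_ h2)[d d0 hd].
    by apply/near_nm; exists d => // x /hd; have := nm_sub (x / la ^+ N) (z / la ^+ N); lra.
  have n3 : \forall x \near z, forall n, (n <= N)%N -> nm (f (z0 / la ^+ n) - f (x / la ^+ n)) < 1 / 100.
    have n4 n : (n <= N)%N -> \forall x \near z, nm (f (z0 / la ^+ n) - f (x / la ^+ n)) < 1 / 100.
      move=> hn; have := cfs n (1 / 100 - nm (f (z0 / la ^+ n) - f (z / la ^+ n))).
      rewrite subr_gt0 => /(_ (h3 _ hn))[d d0 hd]; apply/near_nm; exists d => // x /hd.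
      have := nm_tri (f (z / la ^+ n)) (f (z0 / la ^+ n)) (f (x / la ^+ n)).
      rewrite (nmC (f (x / _)) (f (z / _))); lra.
    have : forall m, (m <= N)%N -> \forall x \near z, forall n, (n <= m)%N ->
        nm (f (z0 / la ^+ n) - f (x / la ^+ n)) < 1 / 100.
      elim=> [|m IH] hm.
        by apply: filterS (n4 _ hm) => x hx n; rewrite leqn0 => /eqP ->.
      have := IH (ltnW hm); have := n4 _ hm; apply: filterS2 => x hx hy n.
      by rewrite leq_eqVlt => /orP[/eqP ->//|]; rewrite ltnS; exact: hy.
    by move=> /(_ N (leqnn _)).
  apply: filterS3 n1 n2 n3 => x x1 x2 x3.
  by split => //; exists N; split.
- move=> _ _ [z0 e0 ->] [z1 e1 ->] [z [[Vz [N s0z]] [_ [M s1z]]]].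
  suff -> : z0 = z1 by [].
  apply: (@same_sheet_uniq z); rewrite ?e0//.
    by exists N; exact: shadow_sym.
  by exists M; exact: shadow_sym.
- apply/seteqP; split => [z Vz|z [_ [z0 e0 ->] []]//].
  have [N hN] := sheet_section (VW _ Vz).
  have [|z0 e0 sz] := hN w hw.
    by rewrite nmC; apply: lt_le_trans s1.
  exists (U z0); first by exists z0.
  by split => //; exists N; exact: shadow_sym.
- move=> _ [z0 e0 ->].
  have oz0 : 3 / 5 < nm (f z0) by rewrite e0.
  have [N hN] := sheet_section oz0.
  have /(_ _)/cid sec y : exists z, V y -> f z = y /\ shadow N z0 z.
    have [Vy|nVy] := pselect (V y); last by exists 0.
    have [|z ez sz] := hN y (VW _ Vy); first by rewrite e0; apply: lt_le_trans s1.
    by exists z.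
  pose g y := sval (sec y).
  have gP y : V y -> f (g y) = y /\ shadow N z0 (g y) by rewrite /g; case: (sec y).
  have fg z : U z0 z -> g (f z) = z.
    move=> [Vz sz]; have [e1 e2] := gP _ Vz.
    by apply: (@same_sheet_uniq z0); rewrite ?e1//; [exact: VW|exists N].
  exists g; split; last split.
  + split.
    * by move=> z [].
    * by move=> y Vy; have [e1 e2] := gP _ Vy; split; rewrite ?e1//; exists N.
    * by move=> z /set_mem; exact: fg.
    * by move=> y /set_mem Vy; have [] := gP _ Vy.
  + apply: continuous_subspaceT => z; apply/cont_atP; exact: (po_cont P).
  + rewrite continuous_open_subspace// => y /set_mem Vy; apply/cont_atP => e e0'.
    pose c := nm la ^+ N * 2; have c0 : 0 < c.
      by rewrite mulr_gt0// exprn_gt0// (lt_trans ltr01)// (po_la P).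
    have [d d0 hd] : exists2 d : R, 0 < d & forall x, nm (x - y) < d -> V x.
      apply/near_nm; apply: open_nbhs_nbhs; split => //.
    exists (Num.min d (e / c)); first by rewrite lt_min d0 divr_gt0.
    move=> x; rewrite lt_min ltr_pdivlMr// => /andP[/hd Vx hx].
    have [e1 sx] := gP _ Vx; have [e2 sy] := gP _ Vy.
    have gx : 3 / 5 < nm (f (g x)) by rewrite e1; exact: VW.
    have := shadow_lip gx sx sy; rewrite e1 e2 mulrA -/c => h.
    by apply: le_lt_trans h _; rewrite mulrC.
Qed.

Lemma poincare_class_B : class_B f.
Proof.
split; [exact: poincare_entire P|exact: poincare_transcendental P|].
have clS : closed [set w : CC R | nm w <= 3 / 5].
  rewrite -openC; apply: open_nm => z /= /negP; rewrite -ltNge => hz.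
  exists (nm z - 3 / 5); first by rewrite subr_gt0.
  by move=> w hw; apply/negP; rewrite -ltNge; have := nm_sub z w; rewrite nmC; lra.
have [_ _ smallest] := singular_set_smallest f.
exists 1; split => // M M1 z hz /=.
have : nm z <= 3 / 5.
  apply: (smallest [set w : CC R | nm w <= 3 / 5]) => //.
  have -> : ~` [set w : CC R | nm w <= 3 / 5] = [set w | 3 / 5 < nm w].
    by apply/seteqP; split => w /= => [/negP|h]; [|apply/negP]; rewrite -ltNge.
  exact: outer_covering.
move=> h; apply: le_trans (ltW M1); rewrite nm_normr.
by rewrite (_ : 1 = 1%:C)// lecR; lra.
Qed.
End Fixed.
End Covering.

(** * Lifting the conjugacy to the Poincaré functions *)

Section Lift.
Context {R : realType}.
Implicit Types (x y z w : CC R).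

(** Near 0, [phi] is the branch of g^{-1} h f that vanishes at 0. Injectivity of [g] there turns the
    conjugacy equation into [phi (la * z) = mu * phi z], which extends [phi] to the plane. *)
Lemma poincare_lift (a be la b ga mu : CC R) f g r r' h :
  poincare a be la f r -> poincare b ga mu g r' ->
  (forall z, cont_at h z) -> (forall z, h (cub a z) = cub b (h z)) -> h be = ga ->
  exists phi, [/\ forall z, cont_at phi z, phi 0 = 0, forall z, phi (la * z) = mu * phi z
    & forall z, g (phi z) = h (f z)].
Proof.
move=> P Q ch hE hb.
have m0 : 0 <= nm mu by exact: nm_ge0.
(* Chosen so that [mu * phi0 z], of modulus at most [2 * e * nm mu], is still in the disc where [g]
   is injective. *)
pose e := r' / (2 * (nm mu + 1)).
have M0 : 0 < 2 * (nm mu + 1) by lra.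
have e0 : 0 < e by rewrite divr_gt0// (po_r Q).
have er : e * (2 * (nm mu + 1)) = r' by rewrite /e divfK// gt_eqF.
have chf z : cont_at (h \o f) z by apply: cont_at_comp => //; exact: (po_cont P).
have [d d0 hd] := chf 0 e e0; rewrite /= (po_0 P) hb in hd.
have e2 : e <= r' / 2 by have := mulr_ge0 (ltW e0) m0; lra.
have /(_ _)/cid hphi z : exists y, nm z < d -> nm y <= 2 * nm (h (f z) - ga) /\ g y = h (f z).
  have [hz|hz] := pselect (nm z < d); last by exists 0.
  have hz' : nm (h (f z) - ga) < r' / 2 by apply: lt_le_trans e2; apply: hd; rewrite subr0.
  by have [y y1 y2] := po_local_inverse Q hz'; exists y.
pose phi0 z := sval (hphi z).
have p1 z : nm z < d -> nm (phi0 z) <= 2 * nm (h (f z) - ga).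
  by rewrite /phi0; case: (hphi z) => y hy /hy[].
have p2 z : nm z < d -> g (phi0 z) = h (f z).
  by rewrite /phi0; case: (hphi z) => y hy /hy[].
have p3 z : nm z < d -> nm (phi0 z) <= 2 * e.
  move=> hz; have := p1 z hz; have := hd z; rewrite subr0 => /(_ hz); lra.
have p4 z : nm z < d -> nm (phi0 z) <= r' by move=> /p3; lra.
have d2 : 0 < d / 2 by rewrite divr_gt0.
have la1 := po_la P; have la0 := po_la0 P.
have sc z : nm z < d -> nm (z / la) < d.
  apply: le_lt_trans; rewrite nmM nmV ler_piMr ?nm_ge0// invf_le1 ?(ltW la1)//.
  exact: lt_trans la1.
have pE z : nm z <= d / 2 -> phi0 z = mu * phi0 (z / la).
  move=> hz; have zd : nm z < d by lra.
  apply: (po_inj Q); first exact: p4.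
    rewrite nmM; have := p3 _ (sc _ zd); have := nm_ge0 (phi0 (z / la)); nra.
  rewrite (po_eq Q) p2// p2; last exact: sc.
  by rewrite -hE -(po_eq P) mulrC divfK.
have [phi [phiE phiS]] := scaling_extension (P := fun y => mu * y) la1 d2 pE.
have z0 : nm (0 : CC R) <= d / 2 by rewrite nm0 ltW.
have lz z : la * (z / la) = z by rewrite mulrC divfK.
have sN z N : z / la / la ^+ N = z / la ^+ N.+1 by rewrite exprS invfM mulrA.
exists phi; split=> //.
- move=> z; have [N /(_ N (leqnn _)) hN] := scale_small z la1 d2.
  elim: N z hN => [|N IH] z hN.
    rewrite expr0 divr1 in hN.
    have dz : 0 < d / 2 - nm z by lra.
    move=> e' e'0; have e'2 : 0 < e' / 2 by rewrite divr_gt0.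
    have [d' d'0 hd'] := chf z _ e'2.
    exists (Num.min (d / 2 - nm z) d'); first by rewrite lt_min dz.
    move=> w; rewrite lt_min => /andP[w1 w2].
    have wd : nm w <= d / 2 by have := nm_sub w z; lra.
    rewrite !phiE ?(ltW hN)//; have wd' : nm w < d by lra.
    have zd' : nm z < d by lra.
    have := po_lower Q (p4 _ wd') (p4 _ zd'); rewrite !p2//.
    by have := hd' w w2; rewrite /=; lra.
  have -> : phi = (fun w => mu * phi (w / la)) by apply/funext => w; rewrite -phiS lz.
  apply: cont_atM; first exact: cont_at_cst.
  apply: (@cont_at_comp _ phi (fun w => w / la)); last by apply: IH; rewrite sN.
  by apply: cont_atM; [exact: cont_at_id|exact: cont_at_cst].
- rewrite phiE//; apply: nm_le0; have := p1 0; rewrite nm0 (po_0 P) hb subrr nm0 mulr0.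
  by apply.
- move=> z; have [N /(_ N (leqnn _)) hN] := scale_small z la1 d2.
  elim: N z hN => [|N IH] z hN.
    rewrite expr0 divr1 in hN; rewrite phiE ?(ltW hN)// p2//; lra.
  by rewrite -(lz z) phiS (po_eq Q) IH ?sN// (po_eq P) hE.
Qed.

(** [f (psi (phi z)) = k (h (f z)) = f z] settles the matter near 0, where [f] is injective; the
    scaling relations carry it outwards. *)
Lemma poincare_lift_cancel (a be la mu : CC R) (f g h k phi psi : CC R -> CC R) (r : R) :
  poincare a be la f r -> cancel h k ->
  (forall z, cont_at phi z) -> (forall z, cont_at psi z) -> phi 0 = 0 -> psi 0 = 0 ->
  (forall z, phi (la * z) = mu * phi z) -> (forall z, psi (mu * z) = la * psi z) ->
  (forall z, g (phi z) = h (f z)) -> (forall z, f (psi z) = k (g z)) ->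
  cancel phi psi.
Proof.
move=> P hk cphi cpsi phi0 psi0 phiS psiS gphi fpsi z.
have la1 := po_la P; have la0 := po_la0 P.
have c0 : cont_at (psi \o phi) 0 by exact: cont_at_comp.
have [d d0 hd] := c0 r (po_r P); rewrite /= phi0 psi0 in hd.
have m0 : 0 < Num.min d r by rewrite lt_min d0 (po_r P).
have [N /(_ N (leqnn _)) hN] := scale_small z la1 m0.
elim: N z hN => [|N IH] z.
  rewrite expr0 divr1 lt_min => /andP[h1 h2].
  apply: (po_inj P); last by rewrite fpsi gphi hk.
    by have := hd z; rewrite !subr0 => /(_ h1); exact: ltW.
  exact: ltW.
rewrite exprS invfM mulrA => /IH e; have <- : la * (z / la) = z by rewrite mulrC divfK.
by rewrite phiS psiS e.
Qed.

End Lift.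

(** * Winding numbers and orientation *)

Section Winding.
Context {R : realType}.
Implicit Types (s t : R) (w z : CC R) (c : R -> CC R) (H : R * R -> CC R).

Lemma polar w : 0 < complex.Re w ->
  w = (nm w)%:C * expi (atan (complex.Im w / complex.Re w)).
Proof.
case: w => x y /= x0; set u := y / x.
have : y = x * u by rewrite /u mulrC divfK// gt_eqF.
clearbody u => y_E.
have u1 : 0 < 1 + u ^+ 2 by rewrite ltr_pwDl// sqr_ge0.
have s0 : 0 < Num.sqrt (1 + u ^+ 2) by rewrite sqrtr_gt0.
have nw : nm (x +i* y) = x * Num.sqrt (1 + u ^+ 2).
  rewrite /nm /= y_E (_ : x ^+ 2 + (x * u) ^+ 2 = x ^+ 2 * (1 + u ^+ 2)); last by ring.
  by rewrite sqrtrM ?sqr_ge0// sqrtr_sqr gtr0_norm.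
have c_E : cos (atan u) = (Num.sqrt (1 + u ^+ 2))^-1 by exact: cos_atan.
have s_E : sin (atan u) = u * (Num.sqrt (1 + u ^+ 2))^-1.
  have := atanK u; rewrite /tan c_E => h.
  transitivity (sin (atan u) / (Num.sqrt (1 + u ^+ 2))^-1 * (Num.sqrt (1 + u ^+ 2))^-1); last by rewrite h.
  by rewrite invrK mulfK// gt_eqF.
rewrite nw /expi c_E s_E; apply/eqP; rewrite eq_complex /= !mul0r subr0 addr0.
apply/andP; split; apply/eqP; first by rewrite mulfK// gt_eqF.
by rewrite mulrACA mulrAC mulrA mulfK ?gt_eqF// y_E.
Qed.

Lemma Re_near1 w : nm (w - 1) < 1 -> 0 < complex.Re w.
Proof.
move=> h; have := le_lt_trans (Re_le_nm (w - 1)) h.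
by rewrite ReB /= ltr_norml => /andP[]; lra.
Qed.

Lemma continuous_Re (T : topologicalType) (f : T -> CC R) x :
  {for x, continuous f} -> {for x, continuous (fun v : T => complex.Re (f v))}.
Proof.
move=> /cvg_nm h; apply/cvgrPdist_lt => e /h; apply: filterS => t.
by rewrite distrC -ReB; apply: le_lt_trans; exact: Re_le_nm.
Qed.
Lemma continuous_Im (T : topologicalType) (f : T -> CC R) x :
  {for x, continuous f} -> {for x, continuous (fun v : T => complex.Im (f v))}.
Proof.
move=> /cvg_nm h; apply/cvgrPdist_lt => e /h; apply: filterS => t.
by rewrite distrC -ImB; apply: le_lt_trans; exact: Im_le_nm.
Qed.

(** Rouché's argument: [c' / c] stays in the disc of radius 1 around 1, so its argument is a
    continuous arctangent that returns to its initial value. *)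
Lemma winding_close c c' n : continuous c -> continuous c' ->
  (forall t, t \in `[0, 1] -> nm (c' t - c t) < nm (c t)) ->
  c 0 = c 1 -> c' 0 = c' 1 ->
  winding_number_is c 0 n -> winding_number_is c' 0 n.
Proof.
move=> cc cc' close e e' [th [cth c0 cE tE]].
pose w t := c' t / c t.
have w1 t : t \in `[0, 1] -> nm (w t - 1) < 1.
  move=> ht; have ct := c0 t ht; have := close t ht.
  rewrite -{1}[c' t](divfK ct) -/(w t) -{2}[c t]mul1r -mulrBl nmM.
  by rewrite -[X in _ < X -> _]mul1r ltr_pM2r// nm_gt0.
have Rw t : t \in `[0, 1] -> 0 < complex.Re (w t) by move=> /w1; exact: Re_near1.
pose al t := atan (complex.Im (w t) / complex.Re (w t)).
exists (fun t => th t + al t); split.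
- have cal : {within `[0, 1], continuous al}.
    apply: continuous_in_subspaceT => t /set_mem /= ht.
    have ht' : t \in `[0, 1] by rewrite inE.
    have cw : {for t, continuous w}.
      apply: (@continuousM _ _ c' (fun t => (c t)^-1)); first exact: cc'.
      by apply: continuousV; [exact: c0|exact: cc].
    apply: (@continuous_comp _ _ _ (fun t => complex.Im (w t) / complex.Re (w t)) atan).
      apply: (@continuousM _ _ (fun t => complex.Im (w t)) (fun t => (complex.Re (w t))^-1)).
        exact: continuous_Im.
      by apply: continuousV; [rewrite gt_eqF// Rw|exact: continuous_Re].
    exact: continuous_atan.
  by move=> t; apply: cvgD; [exact: cth|exact: cal].
- move=> t ht; apply/eqP => c'0; have := close t ht.
  by rewrite c'0 sub0r nmN ltxx.
- move=> t ht; rewrite subr0.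
  have ct := c0 t ht; have := cE t ht; rewrite subr0 => ce.
  have we := polar (Rw t ht).
  have c'e : c' t = c t * w t by rewrite /w mulrC divfK.
  rewrite c'e {1}ce {1}we !nm_normr nmM expiD /= rmorphM /=.
  by rewrite mulrACA.
- have alE : al 1 = al 0 by rewrite /al /w e e'.
  by rewrite alE opprD addrACA subrr addr0.
Qed.

Lemma continuous_slice H s : continuous H -> continuous (fun t => H (s, t)).
Proof.
move=> cH t; apply: (@continuous_comp _ _ _ (fun t => (s, t)) H); last exact: cH.
move=> A /nbhs_ballP[e /= e0 hA]; apply/nbhs_ballP; exists e => //= y hy.
by apply: hA; split => //=; exact: ballxx.
Qed.

(** Compactness of the square gives one mesh for which consecutive loops satisfy the hypothesis of
    [winding_close]. *)
Lemma homotopy_uniform H : continuous H ->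
  (forall s t, s \in `[0, 1] -> t \in `[0, 1] -> H (s, t) != 0) ->
  exists N : nat, forall s s' t, s \in `[0, 1] -> t \in `[0, 1] -> `|s' - s| <= N.+1%:R^-1 ->
    nm (H (s', t) - H (s, t)) < nm (H (s, t)).
Proof.
move=> cH H0.
have K : compact (`[0, 1]%classic `*` `[0, 1]%classic : set (R * R)).
  by apply: compact_setX; exact: segment_compact.
move: K => /compact_near_coveringP NC.
have := NC nat \oo
  (fun N (p : R * R) => forall s', `|s' - p.1| <= N.+1%:R^-1 ->
     nm (H (s', p.2) - H p) < nm (H p)) _.
case=> [[s0 t0] [/= hs ht]|N _ hN]; last first.
- exists N => s s' t hs ht hss.
  exact: (hN N (leqnn N) (s, t) (conj hs ht) s' hss).
- pose k := nm (H (s0, t0)); have k0 : 0 < k by apply: nm_gt0; exact: H0.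
  have /cvg_nm/(_ (k / 3)) := cH (s0, t0).
  rewrite divr_gt0// => /(_ isT) /nbhs_ballP[d /= d0 hd].
  have d2 : 0 < d / 2 by rewrite divr_gt0.
  exists (ball (s0, t0) (d / 2), [set N : nat | N.+1%:R^-1 < d / 2]).
    split => /=; first exact: nbhsx_ballx.
    exact: near_infty_natSinv_lt (PosNum d2).
  move=> [[s t] N] [/= [b1 b2] hN] s' hs'; rewrite /= in b1 b2 hs' *.
  have B1 : nm (H (s, t) - H (s0, t0)) < k / 3.
    by apply: hd; split => /=; [move: b1|move: b2]; apply: le_ball; lra.
  have B2 : nm (H (s', t) - H (s0, t0)) < k / 3.
    apply: hd; split => /=; last by move: b2; apply: le_ball; lra.
    move: b1; rewrite /ball /= => b1.
    have h1 := le_lt_trans hs' hN; have h2 := ler_distD s s0 s'.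
    by apply: le_lt_trans h2 _; rewrite (distrC s s'); lra.
  have := nm_tri (H (s0, t0)) (H (s', t)) (H (s, t)).
  have := nm_sub (H (s0, t0)) (H (s, t)).
  rewrite (nmC (H (s0, t0)) (H (s, t))) -/k; lra.
Qed.

Lemma winding_homotopy H n : continuous H ->
  (forall s t, s \in `[0, 1] -> t \in `[0, 1] -> H (s, t) != 0) ->
  (forall s, H (s, 0) = H (s, 1)) ->
  winding_number_is (fun t => H (0, t)) 0 n -> winding_number_is (fun t => H (1, t)) 0 n.
Proof.
move=> cH H0 Hc W.
have [N hN] := homotopy_uniform cH H0.
have N0 : 0 < N.+1%:R :> R by rewrite ltr0n.
have step k : (k <= N.+1)%N -> winding_number_is (fun t => H (k%:R / N.+1%:R, t)) 0 n.
  elim: k => [|k IH] hk; first by rewrite mul0r.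
  apply: winding_close (IH (ltnW hk)); try exact: continuous_slice.
  - move=> t ht; apply: hN => //.
      rewrite in_itv /= divr_ge0//= ler_pdivrMr// mul1r ler_nat; exact: ltnW.
    by rewrite -mulrBl -natr1 addrC addKr mul1r ger0_norm// invr_ge0 ltW.
  - exact: Hc.
  - exact: Hc.
by have := step N.+1 (leqnn _); rewrite divff// gt_eqF.
Qed.

Lemma winding_shift c p n : winding_number_is (fun t => c t - p) 0 n <-> winding_number_is c p n.
Proof.
split=> -[th [h1 h2 h3 h4]]; exists th; split => // t ht.
- by have := h2 t ht; rewrite subr_eq0.
- by have := h3 t ht; rewrite subr0.
- by rewrite subr_eq0; exact: h2.
- by rewrite subr0; exact: h3.
Qed.

End Winding.

(** * Orientation of maps near the identity and of lifts *)

Section Orientation.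
Context {R : realType}.
Implicit Types (s t : R) (w z : CC R) (phi h : CC R -> CC R).

Definition ray (rho t : R) : CC R := rho%:C * expi (t * (2 * pi)).

Lemma continuous_real_complex (T : topologicalType) (u : T -> R) x :
  {for x, continuous u} -> {for x, continuous (fun v : T => (u v)%:C : CC R)}.
Proof.
move=> /cvgrPdist_lt hu; apply/cvg_nm => e /hu; apply: filterS => v.
by rewrite -rmorphB nm_real distrC.
Qed.

Lemma continuous_expi (T : topologicalType) (u : T -> R) x :
  {for x, continuous u} -> {for x, continuous (fun v : T => expi (u v))}.
Proof.
move=> /cvgrPdist_lt hu; apply/cvg_nm => e e0; have [d d0 hd] := expi_cont (u x) e0.
by have := hu d d0; apply: filterS => v; rewrite distrC; exact: hd.
Qed.

Record cont2 (u : R * R -> CC R) : Prop := Cont2 { cont2P : continuous u }.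

Lemma cont2_cst c : cont2 (fun=> c).
Proof. by split=> p; exact: cvg_cst. Qed.
Lemma cont2_fst : cont2 (fun p => p.1%:C).
Proof. by split=> p; apply: continuous_real_complex; exact: cvg_fst. Qed.
Lemma cont2_expi : cont2 (fun p => expi (p.2 * (2 * pi))).
Proof.
split=> p; apply: (@continuous_expi _ (fun p : R * R => p.2 * (2 * pi)) p).
by apply: cvgM; [exact: cvg_snd|exact: cvg_cst].
Qed.
Lemma cont2D u v : cont2 u -> cont2 v -> cont2 (fun p => u p + v p).
Proof. by move=> [cu] [cv]; split=> p; apply: cvgD; [exact: cu|exact: cv]. Qed.
Lemma cont2B u v : cont2 u -> cont2 v -> cont2 (fun p => u p - v p).
Proof. by move=> [cu] [cv]; split=> p; apply: cvgB; [exact: cu|exact: cv]. Qed.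
Lemma cont2M u v : cont2 u -> cont2 v -> cont2 (fun p => u p * v p).
Proof.
move=> [cu] [cv]; split=> p.
exact: (@cvgM (CC R) _ (nbhs p) _ u v _ _ (cu p) (cv p)).
Qed.
Lemma cont2_comp phi u : (forall z, cont_at phi z) -> cont2 u -> cont2 (fun p => phi (u p)).
Proof.
move=> cphi [cu]; split=> p; apply/cvg_nm => e /(cphi (u p))[d d0 hd].
have /cvg_nm/(_ d d0) := cu p; apply: filterS => q; exact: hd.
Qed.
Lemma cont2_ray r0 r1 : cont2 (fun p => ray (r0 + p.1 * r1) p.2).
Proof.
rewrite /ray; apply: cont2M; last exact: cont2_expi.
rewrite (_ : (fun p : R * R => _) = (fun p => r0%:C + p.1%:C * r1%:C)).
  by apply: cont2D; [|apply: cont2M]; [exact: cont2_cst|exact: cont2_fst|exact: cont2_cst].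
by apply/funext => p; rewrite rmorphD rmorphM.
Qed.
Lemma cont2_ray_cst rho : cont2 (fun p => ray rho p.2).
Proof.
have := cont2_ray rho 0.
by rewrite (_ : (fun p : R * R => _) = fun p => ray rho p.2)//; apply/funext => p; rewrite mulr0 addr0.
Qed.

Lemma expi_2pi : expi (2 * pi) = 1 :> CC R.
Proof.
rewrite mulr_natl mulr2n expiD (_ : expi pi = -1) ?mulrNN ?mulr1//.
by apply/eqP; rewrite eq_complex /= cospi sinpi oppr0 !eqxx.
Qed.

Lemma ray_loop rho : ray rho 0 = ray rho 1.
Proof. by rewrite /ray mul0r mul1r expi_2pi expi0. Qed.

Lemma nm_ray rho t : 0 < rho -> nm (ray rho t) = rho.
Proof. by move=> r0; rewrite nmM nm_expi mulr1 nm_real gtr0_norm. Qed.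

Lemma ray_neq0 rho t : 0 < rho -> ray rho t != 0.
Proof. by move=> r0; apply/eqP => e; have := nm_ray t r0; rewrite e nm0; lra. Qed.

Lemma winding_ray rho : 0 < rho -> winding_number_is (ray rho) 0 1.
Proof.
move=> r0; exists (fun t => t * (2 * pi)); split.
- apply: continuous_subspaceT => t.
  by apply: (@continuousM _ _ id (fun=> 2 * pi)); [exact: cvg_id|exact: cst_continuous].
- by move=> t _; exact: ray_neq0.
- by move=> t _; rewrite subr0 nm_normr nm_ray.
- by rewrite mul0r subr0.
Qed.

Lemma in01 s : s \in `[0, 1] -> 0 <= s <= 1. Proof. by rewrite in_itv. Qed.

(** Centre and radius are moved linearly from one circle to the other; injectivity keeps the
    difference from vanishing, so one circle decides for all. *)
Lemma orientation_preserving_one phi z0 r0 : (forall z, cont_at phi z) -> injective phi ->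
  0 < r0 -> winding_number_is (phi \o circle z0 r0) (phi z0) 1 -> orientation_preserving phi.
Proof.
move=> cphi iphi r00 W z1 r1 r10.
pose zs (p : R * R) : CC R := z0 + p.1%:C * (z1 - z0).
pose rs (p : R * R) : R := r0 + p.1 * (r1 - r0).
pose H (p : R * R) := phi (zs p + ray (rs p) p.2) - phi (zs p).
have czs : cont2 zs.
  apply: cont2D; first exact: cont2_cst.
  by apply: cont2M; [exact: cont2_fst|exact: cont2_cst].
have cH : cont2 H.
  apply: cont2B; last exact: cont2_comp.
  by apply: cont2_comp => //; apply: cont2D => //; exact: cont2_ray.
have H0 s t : s \in `[0, 1] -> t \in `[0, 1] -> H (s, t) != 0.
  move=> /in01/andP[s0 s1] _; rewrite /H subr_eq0; apply/eqP => /iphi /eqP.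
  rewrite -subr_eq0 addrAC subrr add0r; apply/negP; apply: ray_neq0.
  by rewrite /rs /=; nra.
have Hc s : H (s, 0) = H (s, 1) by rewrite /H /zs /rs /= ray_loop.
have e0 : (fun t => H (0, t)) = (fun t => (phi \o circle z0 r0) t - phi z0).
  by apply/funext => t; rewrite /H /zs /rs /= !mul0r !addr0.
have e1 : (fun t => H (1, t)) = (fun t => (phi \o circle z1 r1) t - phi z1).
  apply/funext => t; rewrite /H /zs /rs /= !mul1r [z0 + _]addrC [r0 + _]addrC !subrK.
  by [].
apply/winding_shift; rewrite -e1; apply: (winding_homotopy (cont2P cH) H0 Hc).
by rewrite e0; apply/winding_shift.
Qed.

(** On the unit circle the straight-line homotopy to the identity moves points by at most 1/50, well
    short of 0. *)
Lemma orientation_near_id h : (forall z, cont_at h z) -> injective h ->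
  (forall z, nm (h z - z) <= 1 / 100) -> orientation_preserving h.
Proof.
move=> ch ih nh; apply: (@orientation_preserving_one h 0 1) => //.
pose H (p : R * R) := ray 1 p.2 + p.1%:C * (h (ray 1 p.2) - h 0 - ray 1 p.2).
have cr : cont2 (fun p => ray 1 p.2) by exact: cont2_ray_cst.
have cH : cont2 H.
  apply: cont2D => //; apply: cont2M; first exact: cont2_fst.
  apply: cont2B => //; apply: cont2B; [exact: cont2_comp|exact: cont2_cst].
have H0 s t : s \in `[0, 1] -> t \in `[0, 1] -> H (s, t) != 0.
  move=> /in01/andP[s0 s1] _; apply/eqP => e.
  have := nm_add (ray 1 t) (s%:C * (h (ray 1 t) - h 0 - ray 1 t)).
  rewrite /H /= in e; rewrite e nm0 nm_ray// nmM nm_real ger0_norm//.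
  have : nm (h (ray 1 t) - h 0 - ray 1 t) <= 1 / 50.
    rewrite (_ : _ - _ = (h (ray 1 t) - ray 1 t) - (h 0 - 0)); last by ring.
    apply: le_trans (nmB _ _) _; have := nh 0; have := nh (ray 1 t); lra.
  have := nm_ge0 (h (ray 1 t) - h 0 - ray 1 t); nra.
have Hc s : H (s, 0) = H (s, 1) by rewrite /H /= ray_loop.
have e0 : (fun t => H (0, t)) = ray 1.
  by apply/funext => t; rewrite /H /= mul0r addr0.
have e1 : (fun t => H (1, t)) = (fun t => (h \o circle 0 1) t - h 0).
  by apply/funext => t; rewrite /H /= mul1r addrC subrK /circle add0r.
apply/winding_shift; rewrite -e1; apply: (winding_homotopy (cont2P cH) H0 Hc).
by rewrite e0; apply: winding_ray.
Qed.

(* Near 0, [g (phi z) - ga] is close to [phi z] and [f z] is close to [be + z], so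
   the winding of [phi] along a small circle is that of [h] around [be]. *)
Lemma orientation_lift (a be la b ga mu : CC R) f g r r' h phi :
  poincare a be la f r -> poincare b ga mu g r' ->
  (forall z, cont_at h z) -> injective h -> orientation_preserving h -> h be = ga ->
  (forall z, cont_at phi z) -> injective phi -> phi 0 = 0 ->
  (forall z, g (phi z) = h (f z)) -> orientation_preserving phi.
Proof.
move=> P Q ch ih oh hb cphi iphi phi0 gphi.
have [d d0 hd] := cphi 0 r' (po_r Q); rewrite phi0 in hd.
pose rho := Num.min r (d / 2).
have rho0 : 0 < rho by rewrite lt_min (po_r P) divr_gt0.
have rhor : rho <= r by rewrite /rho ge_min lexx.
have rhod : rho < d.
  have : rho <= d / 2 by rewrite /rho ge_min lexx orbT.
  lra.
apply: (@orientation_preserving_one phi 0 rho) => //.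
have cr : cont2 (fun p => ray rho p.2) by exact: cont2_ray_cst.
have cf : cont2 (fun p => f (ray rho p.2)) by apply: cont2_comp => //; exact: (po_cont P).
have cphir : cont2 (fun p => phi (ray rho p.2)) by exact: cont2_comp.
have cg : cont2 (fun p => g (phi (ray rho p.2))) by apply: cont2_comp => //; exact: (po_cont Q).
have ray_r t : nm (ray rho t) <= r by rewrite nm_ray.
have nm0r : nm (0 : CC R) <= r by rewrite nm0 ltW// (po_r P).
have nm0r' : nm (0 : CC R) <= r' by rewrite nm0 ltW// (po_r Q).
have W1 : winding_number_is (fun t => h (f (ray rho t)) - h be) 0 1.
  pose A (p : R * R) := be + ray rho p.2 + p.1%:C * (f (ray rho p.2) - be - ray rho p.2).
  pose H p := h (A p) - h be.
  have cA : cont2 A.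
    apply: cont2D; first by apply: cont2D => //; exact: cont2_cst.
    apply: cont2M; first exact: cont2_fst.
    by apply: cont2B => //; apply: cont2B => //; exact: cont2_cst.
  have cH : cont2 H by apply: cont2B; [exact: cont2_comp|exact: cont2_cst].
  have H0 s t : s \in `[0, 1] -> t \in `[0, 1] -> H (s, t) != 0.
    move=> /in01/andP[s0 s1] _; rewrite /H subr_eq0; apply/eqP => /ih /eqP.
    rewrite -subr_eq0 (_ : A (s, t) - be = ray rho t + s%:C * (f (ray rho t) - be - ray rho t)); last by rewrite /A /=; ring.
    move=> /eqP e.
    have := nm_add (ray rho t) (s%:C * (f (ray rho t) - be - ray rho t)).
    rewrite e nm0 nm_ray// nmM nm_real ger0_norm//.
    have := po_lip P (ray_r t) nm0r; rewrite !subr0 (po_0 P) nm_ray//.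
    have := nm_ge0 (f (ray rho t) - be - ray rho t); nra.
  have Hc s : H (s, 0) = H (s, 1) by rewrite /H /A /= ray_loop.
  have e0 : (fun t => H (0, t)) = (fun t => (h \o circle be rho) t - h be).
    by apply/funext => t; rewrite /H /A /= mul0r addr0.
  have e1 : (fun t => H (1, t)) = (fun t => h (f (ray rho t)) - h be).
    apply/funext => t; rewrite /H /A /= mul1r; congr (h _ - _); ring.
  rewrite -e1; apply: (winding_homotopy (cont2P cH) H0 Hc).
  by rewrite e0; apply/winding_shift; exact: oh.
have e2 : (fun t => h (f (ray rho t)) - h be) = (fun t => g (phi (ray rho t)) - ga).
  by apply/funext => t; rewrite gphi hb.
rewrite {}e2 in W1.
pose H (p : R * R) := (g (phi (ray rho p.2)) - ga) +
   p.1%:C * (phi (ray rho p.2) - (g (phi (ray rho p.2)) - ga)).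
have cgg : cont2 (fun p => g (phi (ray rho p.2)) - ga).
  by apply: cont2B => //; exact: cont2_cst.
have cH : cont2 H.
  by apply: cont2D => //; apply: cont2M; [exact: cont2_fst|exact: cont2B].
have H0 s t : s \in `[0, 1] -> t \in `[0, 1] -> H (s, t) != 0.
  move=> /in01/andP[s0 s1] _; rewrite /H /=; set y := phi (ray rho t); set u := g y - ga.
  apply/eqP => e.
  have y0 : y != 0.
    apply/eqP; rewrite /y -phi0 => /iphi /eqP; apply/negP; exact: ray_neq0.
  have yr : nm y <= r'.
    by apply: ltW; have := hd (ray rho t); rewrite !subr0 nm_ray// => /(_ rhod).
  have := po_lip Q yr nm0r'; rewrite !subr0 (po_0 Q) -/u => h1.
  have ey : u + s%:C * (y - u) = y + (1 - s)%:C * (u - y).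
    by rewrite rmorphB rmorph1 /=; ring.
  have := nm_add y ((1 - s)%:C * (u - y)); rewrite -ey e nm0 nmM nm_real ger0_norm ?subr_ge0//.
  have := nm_gt0 y0; have := nm_ge0 (u - y); nra.
have Hc s : H (s, 0) = H (s, 1) by rewrite /H /= ray_loop.
have e0 : (fun t => H (0, t)) = (fun t => g (phi (ray rho t)) - ga).
  by apply/funext => t; rewrite /H /= mul0r addr0.
have e1 : (fun t => H (1, t)) = (fun t => (phi \o circle 0 rho) t - phi 0).
  by apply/funext => t; rewrite /H /= mul1r addrC subrK /circle add0r phi0 subr0.
apply/winding_shift; rewrite -e1; apply: (winding_homotopy (cont2P cH) H0 Hc).
by rewrite e0.
Qed.

End Orientation.

(** * Growth *)

Section Order.
Context {R : realType}.
Implicit Types (x z w : CC R).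

Lemma log_plus_le (x y : R) : 1 <= y -> x <= y -> log_plus x <= ln y.
Proof.
move=> y1 xy; rewrite /log_plus ge_max ln_ge0//=.
have [x0|x0] := leP x 0; first by rewrite ln0// ln_ge0.
by rewrite ler_ln// posrE (lt_le_trans x0).
Qed.

Lemma log_plus_ge (x y : R) : 0 < x -> x <= y -> ln x <= log_plus y.
Proof.
move=> x0 xy; apply: (@le_trans _ _ (ln y)); last by rewrite /log_plus le_max lexx orbT.
by rewrite ler_ln// posrE (lt_le_trans x0).
Qed.

Section Fixed.
Variables (a be la : CC R) (f : CC R -> CC R) (r : R).
Hypothesis P : poincare a be la f r.
Hypothesis na : nm a = 36 / 125.

Let rho : R := ln 3 / ln (nm la).

(** The factor 2 absorbs the constant term: [2 * ((S / 2) ^+ 3 + 36 / 125) <= S ^+ 3]. *)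
Lemma iter_upper (T : R) n x : 4 <= T -> 2 * nm x <= T -> 2 * nm (iter n (cub a) x) <= T ^+ (3 ^ n).
Proof.
move=> T4 xT; elim: n => [|n IH]; first by rewrite expr1.
rewrite iterS expnSr exprM; set y := iter n _ x in IH *; set S := T ^+ (3 ^ n) in IH *.
have S4 : 4 <= S.
  have T1 : 1 <= T by lra.
  apply: le_trans T4 _; apply: ler_eXnr => //.
  by rewrite expn_gt0.
have h1 := nmD (y ^+ 3) a; rewrite -/(cub a y) nmX na in h1.
have h2 : nm y ^+ 3 <= (S / 2) ^+ 3 by rewrite cube_le ?nm_ge0//; lra.
have h3 : (S / 2) ^+ 3 = S ^+ 3 / 8 by field.
have h4 : 1 <= S ^+ 3 by rewrite exprn_ege1//; lra.
lra.
Qed.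

Lemma iter_lower n x : 4 <= nm x -> 2 * 2 ^+ (3 ^ n) <= nm (iter n (cub a) x).
Proof.
move=> x4; elim: n => [|n IH]; first by rewrite expr1; lra.
rewrite iterS expnSr exprM; set y := iter n _ x in IH *; set S := 2 ^+ (3 ^ n) in IH *.
have S1 : 1 <= S by rewrite exprn_ege1// ler1n.
have h1 := nm_add (y ^+ 3) a; rewrite -/(cub a y) nmX na in h1.
have h2 : (2 * S) ^+ 3 <= nm y ^+ 3 by rewrite cube_le ?nm_ge0//; lra.
have h3 : (2 * S) ^+ 3 = 8 * S ^+ 3 by ring.
have h4 : 1 <= S ^+ 3 by rewrite exprn_ege1.
lra.
Qed.

Let lnL0 : 0 < ln (nm la). Proof. by rewrite ln_gt0// (po_la P). Qed.

(** For the least n with [nm (z / la ^+ n) <= r], the value [f z] is the n-th iterate at a point of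
    a fixed disc, and minimality bounds n by [1 + (ln (nm z) - ln r) / ln (nm la)]. *)
Lemma loglog_upper : exists c : R, forall z, Num.max 1 r < nm z ->
  log_plus (log_plus (nm (f z))) <= rho * ln (nm z) + c.
Proof.
(* The term [expR 1] gives [1 <= ln T], as the outer logarithm requires. *)
pose T := 2 * (nm be + 3 / 2 * r + 2) + expR 1.
have e1 : 0 < expR 1 :> R := expR_gt0 1.
have r0 := po_r P; have b0 := nm_ge0 be; have L1 := po_la P.
have T4 : 4 <= T by rewrite /T; lra.
have T0 : 0 < T by lra.
have lT : 1 <= ln T.
  by rewrite -[leLHS]expRK ler_ln ?posrE//; rewrite /T; lra.
exists (ln 3 * (1 - ln r / ln (nm la)) + ln (ln T)) => z; rewrite gt_max => /andP[z1 zr].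
have z0 : 0 < nm z by lra.
have [N hN] := scale_small z L1 r0.
have ex : exists n, nm (z / la ^+ n) <= r by exists N; exact: ltW (hN N (leqnn _)).
case: (ex_minnP ex) => n hn min.
case: n hn min => [|n] hn min.
  by move: hn; rewrite expr0 divr1; lra.
have zn : r < nm (z / la ^+ n).
  by rewrite ltNge; apply/negP => /min; rewrite ltnn.
have nle : n%:R * ln (nm la) <= ln (nm z) - ln r.
  have L0 : 0 < nm la ^+ n by rewrite exprn_gt0//; lra.
  move: zn; rewrite nmM nmV nmX ltr_pdivlMr// => zn.
  have : ln (r * nm la ^+ n) <= ln (nm z).
    by rewrite ler_ln ?posrE ?mulr_gt0// ltW.
  by rewrite lnM ?posrE// lnXn; [rewrite -mulr_natl; lra|lra].
have fT : 2 * nm (f (z / la ^+ n.+1)) <= T.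
  have nm0r : nm (0 : CC R) <= r by rewrite nm0 ltW.
  have := po_upper P hn nm0r; rewrite subr0 (po_0 P).
  have := nm_sub (f (z / la ^+ n.+1)) be; rewrite /T; lra.
have up := iter_upper n.+1 T4 fT; rewrite -(po_scale P) in up.
have TT : 1 <= T ^+ (3 ^ n.+1) by rewrite exprn_ege1//; lra.
have n3 : 1 <= (3 ^ n.+1)%:R :> R by rewrite ler1n expn_gt0.
have l1 : log_plus (nm (f z)) <= (3 ^ n.+1)%:R * ln T.
  apply: le_trans (log_plus_le TT _) _; first by have := nm_ge0 (f z); lra.
  by rewrite lnXn// mulr_natl.
have l2 : log_plus (log_plus (nm (f z))) <= ln ((3 ^ n.+1)%:R * ln T).
  apply: log_plus_le => //; apply: le_trans n3 _.
  by rewrite ler_peMr// ler0n.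
apply: le_trans l2 _; rewrite lnM ?posrE; try lra.
rewrite addrA lerD2r natrX lnXn// -[_ *+ n.+1]mulr_natl.
have l3 : 0 <= ln (3 : R) by rewrite ln_ge0// ler1n.
have -> : rho * ln (nm z) + ln 3 * (1 - ln r / ln (nm la)) =
    ln 3 * (1 + (ln (nm z) - ln r) / ln (nm la)) by rewrite /rho; ring.
rewrite mulrC ler_wpM2l// -natr1 addrC lerD2l ler_pdivlMr//.
Qed.

Lemma growth_order_le : (growth_order f <= rho%:E)%E.
Proof.
have [c hc] := loglog_upper.
apply/lee_addgt0Pr => e e0; rewrite -EFinD.
pose M := Num.max (Num.max 1 r) (expR ((`|c| + 1) / e)).
apply: (@le_trans _ _ (ereal_sup [set (log_plus (log_plus (Normc.normc (f z)))
                 / ln (Normc.normc z))%:E | z in [set z : CC R | M < Normc.normc z]])).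
  apply: ereal_inf_lbound; exists [set z : CC R | M < Normc.normc z] => //.
  by exists M.
apply: ub_ereal_sup => _ [z /= hz <-]; rewrite lee_fin -/(nm z) -/(nm (f z)).
move: hz; rewrite -/(nm z) gt_max => /andP[h1 h2].
have z1 : 1 < nm z by move: h1; rewrite gt_max => /andP[].
have lz : (`|c| + 1) / e <= ln (nm z).
  by rewrite -[leLHS]expRK ler_ln ?posrE ?expR_gt0//; lra.
have lz0 : 0 < ln (nm z) by rewrite ln_gt0.
rewrite ler_pdivrMr//; apply: le_trans (hc z h1) _.
rewrite mulrDl lerD2l; move: lz; rewrite ler_pdivrMr//.
have := ler_norm c; lra.
Qed.

(** Along [la ^+ n * z1], which tends to infinity, [f] grows like an iterate that escapes from the
    start: modulus 4 is enough for [iter_lower]. *)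
Lemma growth_order_ge : (exists z, 4 <= nm (f z)) -> (rho%:E <= growth_order f)%E.
Proof.
move=> [z1 hz1].
have L1 := po_la P.
have z10 : 0 < nm z1.
  apply: nm_gt0; apply/eqP => e; move: hz1; rewrite e (po_0 P) => h.
  have := nm_sub (be ^+ 3) (- a); rewrite opprK -/(cub a be) (po_fix P) nmN na nmX.
  have := nm_ge0 be; nra.
have l2 : 0 < ln 2 :> R by rewrite ln_gt0// ltr1n.
apply/lee_addgt0Pr => e e0.
suff : ((rho - e)%:E <= growth_order f)%E by rewrite EFinB leeBlDr.
apply: le_ereal_inf_tmp => _ [V [M _ hV] <-].
pose c1 := ln (nm z1); pose c2 := ln (ln (2 : R)).
(* The first summand lets [n * e * ln (nm la)] outweigh all bounded terms; the second makes
   [ln (nm z)] positive. *)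
pose K := (`|c2| + `|rho - e| * `|c1| + `|c1|) / (e * ln (nm la)) + (`|c1| + 1) / ln (nm la).
have [N1 hN1] : exists N : nat, K < N%:R.
  by exists (Num.bound `|K|); apply: le_lt_trans (ler_norm _) _; rewrite archi_boundP.
have k01 : 0 <= (nm la)^-1 < 1.
  by rewrite invr_ge0 nm_ge0/= invf_lt1//; lra.
have [N2 hN2] := geo_lt (Num.max 0 M) k01 z10.
pose n := maxn N1 N2; pose z := la ^+ n * z1.
have L0 : 0 < nm la by lra.
have nz : nm z = nm la ^+ n * nm z1 by rewrite nmM nmX.
have lz : ln (nm z) = n%:R * ln (nm la) + c1.
  by rewrite nz lnM ?posrE ?exprn_gt0// lnXn// mulr_natl.
have Vz : V z.
  apply: hV => /=; rewrite -/(nm z) nz.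
  have := hN2 n (leq_maxr _ _); rewrite exprVn ltr_pdivrMr ?exprn_gt0// mulrC.
  by apply: le_lt_trans; rewrite le_max lexx orbT.
have fz := iter_lower n hz1; rewrite -(po_iter P) -/z in fz.
have p0 : 0 < (2 : R) ^+ (3 ^ n) by rewrite exprn_gt0.
have h1 : (3 ^ n)%:R * ln 2 <= log_plus (nm (f z)).
  have -> : (3 ^ n)%:R * ln 2 = ln (2 ^+ (3 ^ n)) :> R by rewrite lnXn// mulr_natl.
  by apply: log_plus_ge => //; lra.
have n30 : 0 < (3 ^ n)%:R :> R by rewrite ltr0n expn_gt0.
have h2 : n%:R * ln 3 + c2 <= log_plus (log_plus (nm (f z))).
  have -> : n%:R * ln 3 + c2 = ln ((3 ^ n)%:R * ln 2).
    by rewrite lnM ?posrE// natrX lnXn// mulr_natl.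
  by apply: log_plus_ge => //; rewrite mulr_gt0.
apply: (@le_trans _ _ (log_plus (log_plus (nm (f z))) / ln (nm z))%:E); last first.
  by apply: ereal_sup_ubound; exists z.
rewrite lee_fin.
have Kn : K < n%:R by apply: lt_le_trans hN1 _; rewrite ler_nat leq_maxl.
have A0 : 0 <= `|c2| + `|rho - e| * `|c1| + `|c1| by rewrite !addr_ge0// mulr_ge0.
have K1 : `|c1| + 1 < n%:R * ln (nm la).
  rewrite -ltr_pdivrMr//; apply: le_lt_trans Kn; rewrite /K lerDr divr_ge0//.
  by rewrite mulr_ge0 ?(ltW e0) ?(ltW lnL0).
have K2 : `|c2| + `|rho - e| * `|c1| + `|c1| < n%:R * (e * ln (nm la)).
  rewrite -ltr_pdivrMr ?mulr_gt0//; apply: le_lt_trans Kn; rewrite /K lerDl divr_ge0//.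
  exact: ltW.
have lz0 : 0 < ln (nm z) by rewrite lz; have := ler_norm (- c1); rewrite normrN; lra.
rewrite ler_pdivlMr//; apply: le_trans h2; rewrite lz.
have er : rho * ln (nm la) = ln 3 by rewrite /rho divfK// gt_eqF.
have a1 := ler_norm (- c2); rewrite normrN in a1.
have a2 : (rho - e) * c1 <= `|rho - e| * `|c1| by rewrite -normrM ler_norm.
have a3 := normr_ge0 c1.
have -> : (rho - e) * (n%:R * ln (nm la) + c1) =
  n%:R * (rho * ln (nm la)) - n%:R * (e * ln (nm la)) + (rho - e) * c1 by ring.
rewrite er; lra.
Qed.
End Fixed.
End Order.

(** * The two functions *)

Section Assembly.
Context {R : realType}.
Implicit Types (z w : CC R).

Lemma homeomorphism_cancel (phi psi : CC R -> CC R) :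
  (forall z, cont_at phi z) -> (forall z, cont_at psi z) -> cancel phi psi -> cancel psi phi ->
  homeomorphism_on setT setT phi.
Proof.
move=> cphi cpsi pq qp; exists psi; split; last split.
- by split => // z _.
- by apply: continuous_subspaceT => z; apply/cont_atP; exact: cphi.
- by apply: continuous_subspaceT => z; apply/cont_atP; exact: cpsi.
Qed.

Lemma nm_sqr z : nm z ^+ 2 = complex.Re z ^+ 2 + complex.Im z ^+ 2.
Proof. by case: z => x y; rewrite /nm /= sqr_sqrtr// addr_ge0 ?sqr_ge0. Qed.

(** Taylor expansion at the fixed point 4/5: to its right on the real axis the distance grows at
    least by the multiplier 48/25. *)
Lemma real_escape n (x : R) : 0 <= x -> exists2 y : R, (48 / 25) ^+ n * x <= y &
  iter n (cub (36 / 125)%:C) (4 / 5 + x)%:C = (4 / 5 + y)%:C.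
Proof.
move=> x0; have p0 m : 0 <= (48 / 25 : R) ^+ m by apply: exprn_ge0; lra.
elim: n => [|n [y hy e]]; first by exists x; rewrite // expr0 mul1r.
have y0 : 0 <= y by apply: le_trans hy; rewrite mulr_ge0.
exists (48 / 25 * y + 12 / 5 * y ^+ 2 + y ^+ 3).
  have := sqr_ge0 y; have := exprn_ge0 3 y0.
  rewrite [(48 / 25) ^+ n.+1]exprS -mulrA; lra.
rewrite iterS e /cub -rmorphXn -rmorphD; congr (_%:C); by field.
Qed.

(* Here |b| = |a| = |be| (1 - |be|^2) forces |1 - ga^2| = 1 - |ga^2|, so ga^2 is a
   positive real number. *)
Lemma equal_moduli_rotation (ga : CC R) (u : CC R) :
  nm u = 1 -> cub (u * (36 / 125)%:C) ga = ga -> nm ga = 4 / 5 -> u = 1 \/ u = -1.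
Proof.
move=> nu e ng; set a : CC R := (36 / 125)%:C in e *.
have na : nm a = 36 / 125 by rewrite nm_real ger0_norm//; lra.
have a0 : a != 0 by apply/eqP => h; move: na; rewrite h nm0; lra.
have b_E : u * a = ga * (1 - ga ^+ 2).
  by rewrite -{1}[u * a](addKr (ga ^+ 3)) -/(cub _ ga) e; ring.
have n1 : nm (1 - ga ^+ 2) = 9 / 25.
  have := congr1 nm b_E; rewrite !nmM nu na ng; lra.
have n2 : nm (ga ^+ 2) = 16 / 25 by rewrite nmX ng; field.
have s1 := nm_sqr (1 - ga ^+ 2); have s2 := nm_sqr (ga ^+ 2).
rewrite n1 ReB ImB /= in s1; rewrite n2 in s2.
have x_E : complex.Re (ga ^+ 2) = 16 / 25 by lra.
have y_E : complex.Im (ga ^+ 2) = 0.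
  by apply/eqP; rewrite -sqrf_eq0; apply/eqP; rewrite x_E in s2; lra.
have g2 : ga ^+ 2 = (16 / 25)%:C.
  by apply/eqP; rewrite eq_complex x_E y_E /= !eqxx.
have e36 : 1 - ga ^+ 2 = (9 / 25)%:C.
  by rewrite g2 -(rmorph1 (real_complex R)) -rmorphB; congr (_%:C); by field.
have f45 : (4 / 5)%:C * (9 / 25)%:C = a by rewrite -rmorphM; congr (_%:C); by field.
have : (ga - (4 / 5)%:C) * (ga + (4 / 5)%:C) = 0.
  by rewrite -subr_sqr g2 -rmorphXn -rmorphB (_ : _ - _ = 0)//; field.
move=> /eqP; rewrite mulf_eq0 subr_eq0 addr_eq0 => /orP[] /eqP g1; [left|right].
  by apply: (mulIf a0); rewrite b_E e36 g1 f45 mul1r.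
by apply: (mulIf a0); rewrite b_E e36 g1 mulNr f45 mulN1r.
Qed.

(** Modulus 5 rather than 4 leaves room for the displacement by [h], as [g (phi z) = h (f z)] must
    also reach 4. *)
Lemma poincare_large (be la : CC R) (f : CC R -> CC R) (r : R) :
  be = (4 / 5)%:C -> poincare (36 / 125)%:C be la f r -> exists z, 5 <= nm (f z).
Proof.
move=> be_E P; have r0 := po_r P.
have x0 : 0 < r / 4 by rewrite divr_gt0.
have [|z _ fz] := po_local_inverse P (y := (4 / 5 + r / 4)%:C).
  rewrite be_E -rmorphB nm_real (_ : 4 / 5 + r / 4 - 4 / 5 = r / 4); last by ring.
  by rewrite gtr0_norm//; lra.
have k01 : 0 <= (25 / 48 : R) < 1 by apply/andP; split; lra.
have [N /(_ N (leqnn _)) hN] := geo_lt 5 k01 x0.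
have [y hy e] := real_escape N (ltW x0).
exists (la ^+ N * z); rewrite (po_iter P) fz e nm_real.
have p0 : 0 < (48 / 25 : R) ^+ N by apply: exprn_gt0; lra.
have : 5 < (48 / 25) ^+ N * (r / 4).
  move: hN; rewrite (_ : 25 / 48 = (48 / 25)^-1); last by rewrite invf_div.
  by rewrite exprVn ltr_pdivrMr// mulrC.
move=> h; apply: le_trans (ler_norm _); lra.
Qed.

End Assembly.

Theorem theorem1p3 (R : realType) :
  exists f g : CC R -> CC R,
    [/\ class_B f, class_B g,
        (growth_order f < +oo)%E & (growth_order g < +oo)%E] /\
    topologically_equivalent f g /\ growth_order f <> growth_order g.
Proof.
have [th [sa th0 th1]] := @small_angle_ex R.
pose a : CC R := (36 / 125)%:C; pose be : CC R := (4 / 5)%:C; pose la := 3 * be ^+ 2.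
pose b := expi th * a.
have na : nm a = 36 / 125 by rewrite nm_real ger0_norm//; lra.
have nbe : nm be = 4 / 5 by rewrite nm_real ger0_norm//; lra.
have nb : nm b = 36 / 125 by rewrite nmM nm_expi mul1r.
have gp : good_pair a b th by split.
have [h [k [ch ck hk kh]]] := conjugacy_ex gp.
have fix_be : cub a be = be by rewrite /cub -rmorphXn -rmorphD; congr (_%:C); by field.
have nla : nm la = 48 / 25 by rewrite nmM nmX nbe (nm_nat 3); field.
have la1 : 1 < nm la by rewrite nla; lra.
have [f [r [r0 [f1 f2 f3 f4]]]] := poincare_ex fix_be erefl la1.
have P : poincare a be la f r by split.
pose ga := h be; pose mu := 3 * ga ^+ 2.
have fix_ga : cub b ga = ga by rewrite /ga -(cj_eq ch) fix_be.
(* The conjugacy keeps the fixed point outside D, and [3 * (3 / 5) ^ 2 > 1] makes its image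
   repelling. *)
have nga : 3 / 5 <= nm ga by apply: (cj_ge ch); rewrite nbe; lra.
have nmu : nm mu = 3 * nm ga ^+ 2 by rewrite nmM nmX (nm_nat 3).
have mu1 : 1 < nm mu by rewrite nmu; nra.
have [g [r' [r'0 [g1 g2 g3 g4]]]] := poincare_ex fix_ga erefl mu1.
have Q : poincare b ga mu g r' by split.
have kga : k ga = be by rewrite /ga hk.
have [phi [cphi phi0 phiS gphi]] := poincare_lift P Q (cj_cont ch) (cj_eq ch) erefl.
have [psi [cpsi psi0 psiS fpsi]] := poincare_lift Q P (cj_cont ck) (cj_eq ck) kga.
have pq := poincare_lift_cancel P hk cphi cpsi phi0 psi0 phiS psiS gphi fpsi.
have qp := poincare_lift_cancel Q kh cpsi cphi psi0 phi0 psiS phiS fpsi gphi.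
have [z hz] := poincare_large erefl P.
have of_E : growth_order f = (ln 3 / ln (nm la))%:E.
  apply/eqP; rewrite eq_le (growth_order_le P na) (growth_order_ge P na)//.
  by exists z; lra.
have og_E : growth_order g = (ln 3 / ln (nm mu))%:E.
  apply/eqP; rewrite eq_le (growth_order_le Q nb) (growth_order_ge Q nb)//.
  exists (phi z); rewrite gphi.
  have := nm_sub (f z) (h (f z)); rewrite nmC; have := cj_near ch (f z); lra.
exists f, g; split; last split.
- split; [exact: poincare_class_B P na|exact: poincare_class_B Q nb| |].
    by rewrite of_E ltry.
  by rewrite og_E ltry.
- exists phi, h; split.
  + exact: homeomorphism_cancel qp.
  + exact: (orientation_lift P Q (cj_cont ch) (can_inj hk)
      (orientation_near_id (cj_cont ch) (can_inj hk) (cj_near ch)) erefl cphi (can_inj pq) phi0 gphi).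
  + exact: homeomorphism_cancel (cj_cont ch) (cj_cont ck) hk kh.
  + exact: (orientation_near_id (cj_cont ch) (can_inj hk) (cj_near ch)).
  + by apply/funext => w /=; rewrite gphi.
- rewrite of_E og_E => -[].
  have l3 : ln 3 != 0 :> R by rewrite gt_eqF// ln_gt0// ltr1n.
  move=> /(mulfI l3) /invr_inj /ln_inj e.
  have : nm la = nm mu by apply: e; rewrite posrE; lra.
  rewrite nla nmu => e2.
  have nga45 : nm ga = 4 / 5 by nra.
  (* The choice of [th] excludes both cases: [0 < th < 1] gives [sin th > 0], and [small_angle]
     keeps [expi th] away from -1. *)
  have [u1|u1] := equal_moduli_rotation (nm_expi th) fix_ga nga45.
    have := congr1 (@complex.Im R) u1; rewrite /expi /= => s0.
    have := @sin_gt0_pi R th; rewrite s0 ltxx => /(_ _)/negP; apply => //.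
    rewrite th0 /=; have := @pi_ge2 R; lra.
  have := sa 1; rewrite normr1 mulr1 u1 => /(_ (lexx _)).
  by rewrite (_ : -1 - 1 = - 2); [rewrite nmN (nm_nat 2); lra|ring].
Qed.
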